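(* There is a unique way to assign to each equivariant matroid $W \curvearrowright M$ (with $M$ loopless) an element $P^W_M(t)\in\mathrm{grVRep}(W)$ such that the following conditions are satisfied: 1. If $\operatorname{rk} M = 0$, then $P^W_M(t)$ is equal to the trivial representation of $W$ in degree $0$. 2. If $\operatorname{rk} M > 0$, then $\deg P^W_M(t) < \tfrac{1}{2}\operatorname{rk} M$. 3. For every $W\curvearrowright M$, $$t^{\operatorname{rk} M} P^W_M(t^{-1}) = \sum_{[F] \in L/W}\operatorname{Ind}_{W_F}^W\left(H^{W_F}_{M_F}(t) \otimes P^{W_F}_{M^F}(t)\right),$$ where $L$ is the lattice of flats of $M$. 4. Given a homomorphism $\varphi:W'\to W$ of finite groups (with $W'$ acting on $M$ through $\varphi$), $P^{W'}_M(t) = \varphi^* P^W_M(t)$. (The element $P_M^W(t)$ is called the equivariant Kazhdan-Lusztig polynomial of $W\curvearrowright M$.)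
   Context: An equivariant matroid $W\curvearrowright M$ is a matroid $M$ on a finite ground set $\mathcal I$ together with a finite group $W$ acting on $\mathcal I$ and preserving $M$. $\mathrm{Rep}(W)$ is the semiring of isomorphism classes of finite-dimensional complex representations of $W$, $\mathrm{VRep}(W)$ is its Grothendieck ring (virtual representations), and $\mathrm{grVRep}(W)=\mathrm{VRep}(W)\otimes_{\mathbb Z}\mathbb Z[t]$. A homomorphism $\varphi:W'\to W$ induces by pullback a ring map $\varphi^*:\mathrm{grVRep}(W)\to\mathrm{grVRep}(W')$; induction and tensor product are extended $\mathbb{Z}[t]$-linearly. The degree of an element of $\mathrm{grVRep}(W)$ is its degree in $t$ (the zero element has degree $-\infty$). The Orlik-Solomon algebra of $M$ is the quotient of the exterior algebra over $\mathbb C$ on generators $e_i$ ($i\in\mathcal I$) by the ideal generated by $\partial e_C$ for all circuits $C$ of $M$, where $e_{\{i_1,\dots,i_r\}}=e_{i_1}\wedge\cdots\wedge e_{i_r}$ and $\partial$ is the derivation with $\partial e_i=1$; $W$ acts by permuting the generators. Its degree $p$ part is denoted $OS^W_{M,p}\in\mathrm{Rep}(W)$. The equivariant characteristic polynomial is $H^W_M(t)=\sum_{p=0}^{\operatorname{rk}M}(-1)^p t^{\operatorname{rk}M-p}\,OS^W_{M,p}\in\mathrm{grVRep}(W)$. For a flat $F\in L$, $W_F\subset W$ is the stabilizer of $F$ (as a set); $M_F$ is the localization, i.e. the matroid on ground set $F$ with lattice of flats $\{G\in L\mid G\le F\}$ (the usual matroid restriction $M|F$); $M^F$ is the matroid on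 ground set $\mathcal I\smallsetminus F$ whose lattice of flats is isomorphic to $\{G\in L\mid G\ge F\}$ (the usual contraction $M/F$). $W_F$ acts on both. The sum over $[F]\in L/W$ is over $W$-orbits of flats with one representative $F$ chosen in each orbit. *)

(* Defs.v *)
From HB Require Import structures.
From mathcomp Require Import all_boot all_order all_algebra.
From mathcomp Require Import all_fingroup all_solvable all_field all_character.
From mathcomp Require Import zify.

Set Implicit Arguments.
Unset Strict Implicit.
Unset Printing Implicit Defensive.

Import Order.TTheory GRing.Theory Num.Theory GroupScope.
Local Open Scope ring_scope.

Record matroid (I : finType) := Matroid {
  indep : {set {set I}};
  indep0 : set0 \in indep;
  indepS : forall A B : {set I}, A \subset B -> B \in indep -> A \in indep;
  indepX : forall A B : {set I}, A \in indep -> B \in indep ->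
    (#|A| < #|B|)%N -> exists2 x, x \in B :\: A & x |: A \in indep
}.

Section MatroidNotions.

Variables (I : finType) (M : matroid I).

Definition mrank (A : {set I}) : nat :=
  \max_(B in indep M | B \subset A) #|B|.

Definition rk : nat := mrank [set: I].

Definition circuit (C : {set I}) : bool :=
  minset [pred A : {set I} | A \notin indep M] C.

Definition flat (F : {set I}) : bool :=
  [forall x, (x \notin F) ==> (mrank F < mrank (x |: F))%N].

Definition flats : {set {set I}} := [set F | flat F].

Definition loopless : bool := [forall x, [set x] \in indep M].

Lemma card_indep_mrank (A B : {set I}) :
  B \in indep M -> B \subset A -> (#|B| <= mrank A)%N.
Proof.
move=> iB sBA.
by apply: (leq_bigmax_cond (F := fun B : {set I} => #|B|)); rewrite iB.
Qed.

Lemma indep_extend (A B : {set I}) : B \in indep M -> B \subset A ->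
  exists C : {set I},
    [/\ C \in indep M, B \subset C, C \subset A & #|C| = mrank A].
Proof.
move=> iB sBA.
have [k] := ubnP (mrank A - #|B|).
elim: k B iB sBA => // k IHk B iB sBA ltk.
have := card_indep_mrank iB sBA; rewrite leq_eqVlt => /predU1P[eqB|ltB].
  by exists B.
pose P := [pred D : {set I} | (D \in indep M) && (D \subset A)].
have [|D /andP[iD sDA] cD] := @eq_bigmax_cond _ P (fun D : {set I} => #|D|).
  by apply/card_gt0P; exists B; rewrite inE iB.
rewrite -[LHS]/(mrank A) in cD.
rewrite cD in ltB.
have [x xDB iBx] := indepX iB iD ltB.
have [xB xD] : x \notin B /\ x \in D by move: xDB; rewrite inE => /andP[].
have sBxA : x |: B \subset A by rewrite subUset sub1set (subsetP sDA).
have ltk' : (mrank A - #|x |: B| < k)%N.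
  by rewrite cardsU1 xB; lia.
have [C [iC sBC sCA cC]] := IHk _ iBx sBxA ltk'.
by exists C; split=> //; apply: subset_trans sBC; apply: subsetUr.
Qed.

End MatroidNotions.

Section RestrictContract.

Variables (I : finType) (M : matroid I) (F : {set I}).

Definition locI := {x : I | x \in F}.
Definition contrI := {x : I | x \notin F}.

Definition loc_indep : {set {set locI}} :=
  [set A : {set locI} | val @: A \in indep M].

(* The rank of a set A in M / F is mrank (A :|: F) - mrank F. *)
Definition contr_indep : {set {set contrI}} :=
  [set A : {set contrI} | mrank M (val @: A :|: F) == (#|A| + mrank M F)%N].


Lemma imset_val_disjointU (A : {set contrI}) (B : {set I}) : B \subset F ->
  #|val @: A :|: B| = (#|A| + #|B|)%N.
Proof.
move=> sBF; rewrite cardsU card_imset; last exact: val_inj.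
suff -> : val @: A :&: B = set0 by rewrite cards0 subn0.
apply/setP=> x; rewrite !inE; apply/negbTE/negP=> /andP[/imsetP[y _ ->] yB].
by have := valP y; rewrite (subsetP sBF).
Qed.

Lemma contr_indepE (B : {set I}) : B \in indep M -> B \subset F ->
  #|B| = mrank M F ->
  forall A, (A \in contr_indep) = (val @: A :|: B \in indep M).
Proof.
move=> iB sBF cB A; rewrite inE.
apply/eqP/idP=> [rAF|iAB].
  have sBAF : B \subset val @: A :|: F.
    by apply: subset_trans sBF _; apply: subsetUr.
  have [C [iC sBC sCA cC]] := indep_extend iB sBAF.
  have leCF : (#|C :&: F| <= #|B|)%N.
    rewrite cB card_indep_mrank ?subsetIr //.
    by apply: indepS iC; apply: subsetIl.
  have eqCF : B = C :&: F.
    by apply/eqP; rewrite eqEcard leCF subsetI sBC sBF.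
  have sCAB : C \subset val @: A :|: B.
    apply/subsetP=> x xC; have := subsetP sCA _ xC.
    by rewrite !inE eqCF inE xC /= orbC => /orP[->|->]; rewrite ?orbT.
  suff <- : C = val @: A :|: B by [].
  by apply/eqP; rewrite eqEcard sCAB imset_val_disjointU // cC rAF cB leqnn.
apply/eqP; rewrite eqn_leq -cB -imset_val_disjointU //; apply/andP; split.
  have [C [iC _ sCA <-]] := indep_extend (indep0 M) (sub0set (val @: A :|: F)).
  rewrite imset_val_disjointU // cB -(cardsID F C) addnC leq_add //.
    rewrite -(card_imset _ val_inj) subset_leq_card //.
    apply/subsetP=> x; rewrite inE => /andP[xF xC].
    by have := subsetP sCA _ xC; rewrite inE (negbTE xF) orbF.
  rewrite card_indep_mrank ?subsetIr //.
  by apply: indepS iC; apply: subsetIl.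
by apply: card_indep_mrank => //; apply: setUS.
Qed.

Lemma loc_indep0 : set0 \in loc_indep.
Proof. by rewrite inE imset0 indep0. Qed.

Lemma loc_indepS (A B : {set locI}) :
  A \subset B -> B \in loc_indep -> A \in loc_indep.
Proof. by rewrite !inE => sAB; apply: indepS; apply: imsetS. Qed.

Lemma loc_indepX (A B : {set locI}) :
  A \in loc_indep -> B \in loc_indep -> (#|A| < #|B|)%N ->
  exists2 x, x \in B :\: A & x |: A \in loc_indep.
Proof.
rewrite !inE => iA iB ltAB.
have [|x] := indepX iA iB; first by rewrite !card_imset //; apply: val_inj.
rewrite inE => /andP[xA /imsetP[y yB xy]] iAx; subst x.
exists y; first by rewrite inE yB andbT; apply: contra xA; apply: imset_f.
by rewrite inE imsetU1.
Qed.

Lemma contr_indep0 : set0 \in contr_indep.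
Proof. by rewrite inE imset0 set0U cards0. Qed.

Lemma contr_indepS (A B : {set contrI}) :
  A \subset B -> B \in contr_indep -> A \in contr_indep.
Proof.
have [C [iC _ sCF cC]] := indep_extend (indep0 M) (sub0set F).
rewrite !(contr_indepE iC) // => sAB; apply: indepS.
by apply: setSU; apply: imsetS.
Qed.

Lemma contr_indepX (A B : {set contrI}) :
  A \in contr_indep -> B \in contr_indep -> (#|A| < #|B|)%N ->
  exists2 x, x \in B :\: A & x |: A \in contr_indep.
Proof.
have [C [iC _ sCF cC]] := indep_extend (indep0 M) (sub0set F).
rewrite !(contr_indepE iC) // => iA iB ltAB.
have [|x] := indepX iA iB; first by rewrite !imset_val_disjointU // ltn_add2r.
rewrite !inE negb_or => /andP[/andP[xA xC]].
rewrite (negbTE xC) orbF => /imsetP[y yB xy] iAx; subst x.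
exists y; first by rewrite inE yB andbT; apply: contra xA; apply: imset_f.
by rewrite (contr_indepE iC) // imsetU1 -setUA.
Qed.

Definition localization : matroid locI :=
  Matroid loc_indep0 loc_indepS loc_indepX.

Definition contraction : matroid contrI :=
  Matroid contr_indep0 contr_indepS contr_indepX.

End RestrictContract.

(* The exterior algebra on the generators e_i is presented as the free
   (tensor) algebra on the e_i modulo e_i e_i and e_i e_j + e_j e_i. Hence the
   degree p part of the Orlik-Solomon algebra is the space with basis the
   words of length p in I, modulo the degree p part of the two-sided ideal
   generated by these relations and by the boundaries of circuits. A circuit
   is represented by all the words enumerating it; they give boundaries that
   only differ by a sign modulo the exterior relations. *)

Section OrlikSolomon.

Variables (I : finType) (M : matroid I) (p : nat).

Definition nwords := #|{: p.-tuple I}|.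

Definition word (j : 'I_nwords) : p.-tuple I := enum_val j.

(* The monomial of the word s; it is 0 if s does not have length p. *)
Definition monomial (s : seq I) : 'rV[algC]_nwords :=
  \row_j (word j == s :> seq I)%:R.

(* u (d e_c) v, where d e_c is the alternating sum of the words obtained by
   deleting one letter of c. *)
Definition boundary_rel (u v c : seq I) : 'rV[algC]_nwords :=
  \sum_(k < size c) (-1) ^+ k *: monomial (u ++ (take k c ++ drop k.+1 c) ++ v).

Definition circuit_word (c : seq I) : bool :=
  uniq c && circuit M [set x in c].

(* Relations in degree p only involve u, v of length at most p and c of length
   at most p.+1. *)
Definition os_ideal : 'M[algC]_nwords :=
  (\sum_(u : p.-bseq I) \sum_(v : p.-bseq I)
    (\sum_(i : I) <<monomial (u ++ [:: i; i] ++ v)>>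
     + \sum_(i : I) \sum_(j : I)
         <<(monomial (u ++ [:: i; j] ++ v)
            + monomial (u ++ [:: j; i] ++ v))%R>>
     + \sum_(c : p.+1.-bseq I | circuit_word c)
         <<boundary_rel u v c>>))%MS.

End OrlikSolomon.

(* MathComp actions are on the right; only the values of eact on W matter. *)
Record eqmatroid (gT : finGroupType) (W : {group gT}) (I : finType) :=
  EqMatroid {
    mat :> matroid I;
    eact : action W I;
    eact_indep : forall (w : gT) (A : {set I}), w \in W ->
      A \in indep mat -> [set eact x w | x in A] \in indep mat
  }.

Section EquivariantOS.

Variables (gT : finGroupType) (W : {group gT}) (I : finType).
Variables (M : eqmatroid W I) (p : nat).

Definition word_mx (w : gT) : 'M[algC]_(nwords I p) :=
  \matrix_(a, b) ([seq eact M x w | x <- word a] == word b)%:R.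

Lemma monomial_word_mx (s : seq I) (w : gT) :
  monomial p s *m word_mx w = monomial p [seq eact M x w | x <- s].
Proof.
apply/rowP=> b; rewrite !mxE.
have [ss|ns] := eqVneq (size s) p.
  pose t : p.-tuple I := Tuple (introT eqP ss).
  rewrite (bigD1 (enum_rank t)) //= big1 => [|a ne_a].
    by rewrite !mxE /word enum_rankK /= eqxx mul1r addr0 eq_sym.
  rewrite !mxE; case: eqP => [ea|]; last by rewrite mul0r.
  case/eqP: ne_a; rewrite -(enum_valK a); congr enum_rank.
  exact: val_inj.
rewrite big1 => [|a _].
  case: eqP => // eb; case/eqP: ns.
  by rewrite -(size_map (fun x => eact M x w)) -eb size_tuple.
rewrite !mxE; case: eqP => [ea|]; last by rewrite mul0r.
by case/eqP: ns; rewrite -ea size_tuple.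
Qed.

Lemma word_mx_repr : mx_repr W word_mx.
Proof.
split=> [|x y Wx Wy].
  apply/matrixP=> a b; rewrite !mxE.
  rewrite (eq_map (g := id)) ?map_id => [|i]; last exact: act1.
  by rewrite (inj_eq val_inj) (inj_eq enum_val_inj).
apply/row_matrixP=> a; rewrite row_mul.
have rE w : row a (word_mx w) =
    monomial p [seq eact M i w | i <- word a].
  by apply/rowP=> b; rewrite !mxE eq_sym.
rewrite !rE monomial_word_mx -map_comp; congr (monomial _ _).
by apply: eq_map => i /=; rewrite actMin.
Qed.

Canonical word_repr := MxRepresentation word_mx_repr.

Lemma eact_circuit (w : gT) (C : {set I}) : w \in W ->
  circuit M C -> circuit M [set eact M x w | x in C].
Proof.
have actK v (A : {set I}) : v \in W ->
    [set eact M x v^-1%g | x in [set eact M x v | x in A]] = A.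
  move=> Wv; rewrite -imset_comp -[RHS]imset_id.
  by apply: eq_imset => x /=; rewrite actKin.
have iE v (A : {set I}) : v \in W ->
    ([set eact M x v | x in A] \in indep M) = (A \in indep M).
  move=> Wv; apply/idP/idP => [iA|]; last exact: eact_indep.
  by rewrite -(actK _ A Wv); apply: eact_indep => //; rewrite groupV.
move=> Ww /minsetP[/= dC minC]; apply/minsetP; split=> [|B /= dB sB].
  by rewrite /= iE.
have WV : w^-1%g \in W by rewrite groupV.
have := minC [set eact M x w^-1%g | x in B].
rewrite /= iE // dB -{1}(actK _ C Ww) imsetS // => /(_ isT isT) <-.
by have := actK _ B WV; rewrite invgK.
Qed.

Lemma boundary_rel_mx (u v c : seq I) (w : gT) :
  boundary_rel p u v c *m word_mx w =
  boundary_rel p [seq eact M x w | x <- u] [seq eact M x w | x <- v]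
    [seq eact M x w | x <- c].
Proof.
rewrite /boundary_rel size_map mulmx_suml; apply: eq_bigr => k _.
by rewrite -scalemxAl monomial_word_mx !map_cat map_take map_drop.
Qed.

Lemma os_ideal_module : mxmodule word_repr (os_ideal M p).
Proof.
apply/mxmoduleP=> w Ww; rewrite /os_ideal sumsmxMr.
apply/sumsmx_subP=> u _; rewrite sumsmxMr; apply/sumsmx_subP=> v _.
pose act n (s : n.-bseq I) : n.-bseq I :=
  map_bseq (fun x => eact M x w) s.
apply: (sumsmx_sup (act _ u)) => //; apply: (sumsmx_sup (act _ v)) => //.
rewrite addsmxMr; apply: addsmxS; first rewrite addsmxMr; first apply: addsmxS.
- rewrite sumsmxMr; apply/sumsmx_subP=> i _.
  apply: (sumsmx_sup (eact M i w)) => //.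
  by rewrite (eqmxMr _ (genmxE _)) genmxE monomial_word_mx !map_cat.
- rewrite sumsmxMr; apply/sumsmx_subP=> i _.
  rewrite sumsmxMr; apply/sumsmx_subP=> j _.
  apply: (sumsmx_sup (eact M i w)) => //.
  apply: (sumsmx_sup (eact M j w)) => //.
  by rewrite (eqmxMr _ (genmxE _)) genmxE mulmxDl !monomial_word_mx !map_cat.
rewrite sumsmxMr; apply/sumsmx_subP=> c /andP[uc Cc].
apply: (sumsmx_sup (act _ c)).
  rewrite /circuit_word /= map_inj_uniq ?uc; last exact: act_inj.
  have /= := eact_circuit Ww Cc.
  congr (circuit _ _); apply/setP=> y; rewrite inE.
  apply/imsetP/mapP=> [[x]|[x xc ->]]; first by rewrite inE; exists x.
  by exists x; rewrite ?inE.
by rewrite (eqmxMr _ (genmxE _)) genmxE boundary_rel_mx.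
Qed.

Definition os_repr := factmod_repr os_ideal_module.

End EquivariantOS.

(* VRep(W) is the ring 'Z[irr W] of virtual characters, and the variable t is
   'X. Induction is 'Ind and tensor product is the product of {poly 'CF(W)}.
   All representations are over algC: finite groups have the same
   representation ring over algC as over the field of complex numbers. *)
Record grVRep (gT : finGroupType) (W : {group gT}) := GrVRep {
  grpoly :> {poly 'CF(W)};
  grpoly_vchar : grpoly \is a polyOver 'Z[irr W]
}.

Section GradedOperations.

Variables (gT : finGroupType) (W : {group gT}).

(* t ^ r * P(1 / t), for P of degree at most r. *)
Definition reverse (r : nat) (P : {poly 'CF(W)}) : {poly 'CF(W)} :=
  \poly_(k < r.+1) P`_(r - k).

Definition grInd (H : {group gT}) (P : {poly 'CF(H)}) : {poly 'CF(W)} :=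
  map_poly 'Ind[W] P.

Variables (gT' : finGroupType) (W' : {group gT'}) (phi : {morphism W' >-> gT}).

(* When phi @* W' \subset W, this is chi \o phi on W'. *)
Definition cfpull (chi : 'CF(W)) : 'CF(W') := cfMorph ('Res[phi @* W'] chi).

Definition grpull (P : {poly 'CF(W)}) : {poly 'CF(W')} := map_poly cfpull P.

End GradedOperations.

Section Equivariant.

Variables (gT : finGroupType) (W : {group gT}) (I : finType).
Variables (M : eqmatroid W I).

Definition os_char (p : nat) : 'CF(W) := cfRepr (os_repr M p).

Definition eqchar : {poly 'CF(W)} :=
  \sum_(p < (rk M).+1) ((-1) ^+ p * os_char p) *: 'X^(rk M - p).

Variable F : {set I}.

Definition stab : {group gT} := 'N_W(F | eact M)%G.

Lemma stab_locI : stab \subset subact_dom (fun x => x \in F) (eact M).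
Proof.
rewrite /= /subact_dom; have -> : [set x | x \in F] = F.
  by apply/setP=> x; rewrite inE.
exact: subsetIr.
Qed.

Lemma stab_contrI : stab \subset subact_dom (fun x => x \notin F) (eact M).
Proof.
rewrite /= /subact_dom; have -> : [set x | x \notin F] = ~: F.
  by apply/setP=> x; rewrite !inE.
by rewrite astabsC subsetIr.
Qed.

Definition loc_act : action stab (locI F) :=
  raction (subaction (locI F) (eact M)) stab_locI.

Definition contr_act : action stab (contrI F) :=
  raction (subaction (contrI F) (eact M)) stab_contrI.

Lemma loc_actE (w : gT) (A : {set locI F}) : w \in stab ->
  val @: [set loc_act x w | x in A] = [set eact M x w | x in val @: A].
Proof.
move=> Sw; rewrite -!imset_comp; apply: eq_imset => x /=.
by rewrite /ract /= val_subact (subsetP stab_locI).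
Qed.

Lemma contr_actE (w : gT) (A : {set contrI F}) : w \in stab ->
  val @: [set contr_act x w | x in A] = [set eact M x w | x in val @: A].
Proof.
move=> Sw; rewrite -!imset_comp; apply: eq_imset => x /=.
by rewrite /ract /= val_subact (subsetP stab_contrI).
Qed.

Lemma loc_act_indep (w : gT) (A : {set locI F}) : w \in stab ->
  A \in indep (localization M F) ->
  [set loc_act x w | x in A] \in indep (localization M F).
Proof.
move=> Sw; rewrite !inE loc_actE //.
by apply: eact_indep; case/setIP: Sw.
Qed.

Lemma eact_mrank (w : gT) (A : {set I}) : w \in W ->
  mrank M [set eact M x w | x in A] = mrank M A.
Proof.
have le_rank v (B : {set I}) : v \in W ->
    (mrank M B <= mrank M [set eact M x v | x in B])%N.
  move=> Wv; have [C [iC _ sCB <-]] := indep_extend (indep0 M) (sub0set B).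
  rewrite -(card_imset C (act_inj (eact M) v)) card_indep_mrank ?imsetS //.
  exact: eact_indep.
move=> Ww; apply/eqP; rewrite eqn_leq le_rank // andbT.
set B := [set eact M x w | x in A].
have -> : A = [set eact M x w^-1%g | x in B].
  rewrite /B -imset_comp -[LHS]imset_id.
  by apply: eq_imset => x /=; rewrite actKin.
by rewrite le_rank ?groupV.
Qed.

Lemma contr_act_indep (w : gT) (A : {set contrI F}) : w \in stab ->
  A \in indep (contraction M F) ->
  [set contr_act x w | x in A] \in indep (contraction M F).
Proof.
move=> Sw; rewrite !inE contr_actE // card_imset; last exact: act_inj.
case/setIP: Sw => Ww /astabs_setact FE.
set B := imset _ _.
have <- : [set eact M x w | x in B :|: F] = [set eact M x w | x in B] :|: F.
  by rewrite imsetU; congr (_ :|: _); apply: FE.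
by rewrite eact_mrank.
Qed.

Definition eqloc : eqmatroid stab (locI F) := EqMatroid loc_act_indep.
Definition eqcontr : eqmatroid stab (contrI F) := EqMatroid contr_act_indep.

End Equivariant.

(* P takes all equivariant matroids as arguments, but the conditions involve
   its values on loopless ones only (the contraction of a loopless matroid by
   a flat is loopless). In the last one, M' is the same matroid as M, with W'
   acting through phi. *)
Record eqKL (P : forall (gT : finGroupType) (W : {group gT}) (I : finType),
    eqmatroid W I -> grVRep W) : Prop := EqKL {
  eqKL_rk0 : forall (gT : finGroupType) (W : {group gT}) (I : finType)
      (M : eqmatroid W I), loopless M ->
    rk M = 0%N -> P gT W I M = 1 :> {poly 'CF(W)};
  (* size of a polynomial: 1 + its degree, or 0 for the zero polynomial *)
  eqKL_deg : forall (gT : finGroupType) (W : {group gT}) (I : finType)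
      (M : eqmatroid W I), loopless M ->
    (0 < rk M)%N -> (2 * (size (P gT W I M)).-1 < rk M)%N;
  eqKL_rec : forall (gT : finGroupType) (W : {group gT}) (I : finType)
      (M : eqmatroid W I), loopless M ->
    reverse (rk M) (P gT W I M) =
      \sum_(F in orbit_transversal (eact M)^* W (flats M))
        grInd W (eqchar (eqloc M F) *
                 P gT (stab M F) (contrI F) (eqcontr M F));
  eqKL_pull : forall (gT gT' : finGroupType) (W : {group gT})
      (W' : {group gT'}) (phi : {morphism W' >-> gT}) (I : finType)
      (M : eqmatroid W I) (M' : eqmatroid W' I), loopless M ->
    phi @* W' \subset W -> indep M' = indep M ->
    (forall x w, w \in W' -> eact M' x w = eact M x (phi w)) ->
    P gT' W' I M' = grpull phi (P gT W I M) :> {poly 'CF(W')}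
}.

(* Main.v *)
(* Evaluated at g in W, the theory becomes Kazhdan-Lusztig-Stanley theory on the
   poset S of the flats fixed by g, graded by the rank of M. The Orlik-Solomon
   relations are homogeneous for the closure of a word, so the trace of g on the
   degree p part is the sum of its traces on the pieces of the flats of S of
   rank p. Left multiplication by a letter of a flat G is a contracting homotopy
   for the boundary of words in G; hence the signed traces of g on the pieces of
   the flats below G add up to 0 unless G is empty, and these signed traces are
   the values of the Moebius function of S. So H_M(g) is the characteristic
   polynomial of S, and the inverse relation between the Moebius and zeta
   functions makes it a kernel in the sense of Stanley, which has a unique
   Kazhdan-Lusztig-Stanley polynomial. Intervals of S being the posets attached
   to localizations and contractions, summing over S gives the sum of induced
   characters over orbits of flats. The class functions so obtained are virtual
   characters by induction on the rank, because the recursion expresses the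
   coefficients of P_M through those of proper contractions. *)

From HB Require Import structures.
Require Import Defs.
From mathcomp Require Import all_boot all_order all_algebra.
From mathcomp Require Import all_fingroup all_solvable all_field all_character.
From mathcomp Require Import zify ring.

Set Implicit Arguments.
Unset Strict Implicit.
Unset Printing Implicit Defensive.

Import Order.TTheory GRing.Theory Num.Theory GroupScope.
Local Open Scope ring_scope.

(** * Closure, localization and contraction *)

Section Closure.

Variables (I : finType) (M : matroid I).
Implicit Types A B C F G : {set I}.

Lemma mrank_basis A :
  exists C : {set I}, [/\ C \in indep M, C \subset A & #|C| = mrank M A].
Proof.
have [C [iC _ sCA cC]] := indep_extend (indep0 M) (sub0set A).
by exists C.
Qed.

Lemma mrankS A B : A \subset B -> (mrank M A <= mrank M B)%N.
Proof.
move=> sAB; have [C [iC sCA <-]] := mrank_basis A.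
by rewrite card_indep_mrank // (subset_trans sCA).
Qed.

Lemma mrank_le_card A : (mrank M A <= #|A|)%N.
Proof. by have [C [_ /subset_leq_card le_CA <-]] := mrank_basis A. Qed.

Lemma indep_mrank A : (A \in indep M) = (mrank M A == #|A|).
Proof.
apply/idP/eqP=> [iA | rA].
  by apply/eqP; rewrite eqn_leq mrank_le_card card_indep_mrank.
have [C [iC sCA cC]] := mrank_basis A.
by have/eqP <- : C == A by rewrite eqEcard sCA cC rA leqnn.
Qed.

Definition mcl A : {set I} := [set x | mrank M (x |: A) == mrank M A].

Lemma mem_mcl A x : (x \in mcl A) = (mrank M (x |: A) <= mrank M A)%N.
Proof. by rewrite inE eqn_leq andbC mrankS ?subsetUr. Qed.

Lemma sub_mcl A : A \subset mcl A.
Proof. by apply/subsetP=> x xA; rewrite inE (setUidPr _) ?sub1set. Qed.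

(** A basis of [A] extends to one of [B]; an element gained on the way would be independent of the
    basis of [A], although it lies in [mcl A]. *)
Lemma mrank_between A B : A \subset B -> B \subset mcl A -> mrank M B = mrank M
  A.
Proof.
move=> sAB sBA; have [C [iC sCA cC]] := mrank_basis A.
have [D [iD sCD sDB cD]] := indep_extend iC (subset_trans sCA sAB).
suff sDC : D \subset C.
  apply/eqP; rewrite eqn_leq andbC mrankS //= -cC -cD.
  exact: subset_leq_card.
apply/subsetP=> x xD; apply: contraTT (subsetP sBA x (subsetP sDB x xD)) => xC.
rewrite mem_mcl -ltnNge -cC.
have: (#|x |: C| <= mrank M (x |: A))%N.
  by rewrite card_indep_mrank ?setUS // (indepS _ iD) // subUset sub1set xD.
by rewrite cardsU1 xC.
Qed.

Lemma mrank_mcl A : mrank M (mcl A) = mrank M A.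
Proof. by rewrite (@mrank_between A) ?sub_mcl. Qed.

(** Take nested bases of [A], [B] and [x |: B]. If [x] raises the rank of [B], it belongs to the
    last basis, so it is independent of the first one and raises the rank of [A]. *)
Lemma mclS A B : A \subset B -> mcl A \subset mcl B.
Proof.
move=> sAB; apply/subsetP=> x; apply: contraTT => xB.
have [C [iC sCA cC]] := mrank_basis A.
have [D [iD sCD sDB cD]] := indep_extend iC (subset_trans sCA sAB).
have [E [iE sDE sEB cE]] := indep_extend iD (subset_trans sDB (subsetUr [set x]
  B)).
have xE : x \in E.
  apply: contraR xB => xE; rewrite mem_mcl -cE.
  rewrite card_indep_mrank //; apply/subsetP=> y yE.
  have := subsetP sEB y yE; rewrite !inE => /orP[/eqP yx|//].
  by rewrite -yx yE in xE.
have xC : x \notin C.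
  apply: contra xB => xC.
  by apply: (subsetP (sub_mcl B)); apply: (subsetP (subset_trans sCA sAB)).
rewrite mem_mcl -ltnNge -cC.
have: (#|x |: C| <= mrank M (x |: A))%N.
  rewrite card_indep_mrank ?setUS // (indepS _ iE) //.
  by rewrite subUset sub1set xE (subset_trans sCD).
by rewrite cardsU1 xC.
Qed.

Lemma mcl_flat A : flat M (mcl A).
Proof.
apply/forallP=> x; apply/implyP=> xA.
rewrite mrank_mcl; move: xA; rewrite mem_mcl -ltnNge => /leq_trans; apply.
by rewrite mrankS // setUS // sub_mcl.
Qed.

Lemma flat_mcl F : flat M F -> mcl F = F.
Proof.
move/forallP=> fF; apply/eqP; rewrite eqEsubset sub_mcl andbT.
apply/subsetP=> x; apply: contraTT => xF.
by rewrite mem_mcl -ltnNge; apply: (implyP (fF x)).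
Qed.

Lemma mcl_sub_flat A F : flat M F -> (mcl A \subset F) = (A \subset F).
Proof.
move=> fF; apply/idP/idP => [|/mclS]; last by rewrite (flat_mcl fF).
exact: subset_trans (sub_mcl A).
Qed.

Lemma mcl_between A B : A \subset B -> B \subset mcl A -> mcl B = mcl A.
Proof.
move=> sAB sBA; apply/eqP.
by rewrite eqEsubset (mclS sAB) andbT mcl_sub_flat // mcl_flat.
Qed.

Lemma flat_mrank_ltn F G : flat M F -> F \proper G -> (mrank M F < mrank M G)%N.
Proof.
move=> /forallP fF /properP[sFG [x xG xF]].
by apply: leq_trans (implyP (fF x) xF) _; rewrite mrankS // subUset sub1set xG.
Qed.

Lemma flatT : flat M [set: I].
Proof. by apply/forallP=> x; rewrite inE. Qed.

Lemma mrank0 : mrank M set0 = 0%N.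
Proof. by apply/eqP; rewrite -leqn0 -[X in (_ <= X)%N](cards0 I) mrank_le_card.
  Qed.

Lemma loopless_flat0 : loopless M -> flat M set0.
Proof.
move=> /forallP lM; apply/forallP=> x; apply/implyP=> _.
by move: (lM x); rewrite indep_mrank setU0 mrank0 cards1 => /eqP->.
Qed.

(** By minimality [C :\ x] is independent when [x] is in [C], so it already has the rank of [C],
    which is at most [#|C| - 1]. *)
Lemma circuit_mcl C x : circuit M C -> C \subset mcl (C :\ x).
Proof.
move=> /minsetP[/= dC minC].
have [xC | xC] := boolP (x \in C); last first.
  by apply: subset_trans (sub_mcl _); rewrite subsetD1 subxx.
have iCx : C :\ x \in indep M.
  apply: contraT => dCx; have := minC (C :\ x) dCx (subsetDl _ _).
  by move/setP/(_ x); rewrite xC !inE eqxx.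
apply/subsetP=> y yC; have [-> | yx] := eqVneq y x; last first.
  by apply: (subsetP (sub_mcl _)); rewrite !inE yx.
rewrite mem_mcl setD1K //.
have := mrank_le_card C; rewrite leq_eqVlt -indep_mrank (negbTE dC) /=.
rewrite (cardsD1 x C) xC; move: iCx; rewrite indep_mrank => /eqP->.
by rewrite ltnS.
Qed.

Lemma dependent_circuit A : A \notin indep M -> exists2 C, circuit M C & C
  \subset A.
Proof.
move=> dA; have := @minset_exists _ [pred B : {set I} | B \notin indep M] A dA.
by case=> C mC sCA; exists C.
Qed.

End Closure.

(** * Ranks, flats and loops of localizations and contractions *)

Section LocContr.

Variables (I : finType) (M : matroid I) (F : {set I}).

Lemma mrank_loc (A : {set locI F}) : mrank (localization M F) A = mrank M (val
  @: A).
Proof.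
apply/eqP; rewrite eqn_leq; apply/andP; split.
  have [C [iC sCA <-]] := mrank_basis (localization M F) A.
  rewrite -(card_imset (mem C) val_inj) card_indep_mrank ?imsetS //.
  by move: iC; rewrite inE.
have [C [iC sCA <-]] := mrank_basis M (val @: A).
have eC : C = val @: (val @^-1: C : {set locI F}).
  apply/setP=> x; apply/idP/imsetP=> [xC|[y]]; last by rewrite inE => yC ->.
  by have /imsetP[y _ xy] := subsetP sCA x xC; exists y; rewrite // inE -xy.
rewrite eC card_imset; last exact: val_inj.
rewrite card_indep_mrank ?inE -?eC //; apply/subsetP=> y; rewrite inE => yC.
by have /imsetP[z zA /val_inj ->] := subsetP sCA _ yC.
Qed.

(** A basis of [F] extends to one of [val @: A :|: F], and the elements added outside [F] form a
    basis of [A] in the contraction. *)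
Lemma mrank_contr (A : {set contrI F}) :
  (mrank (contraction M F) A + mrank M F)%N = mrank M (val @: A :|: F).
Proof.
apply/eqP; rewrite eqn_leq; apply/andP; split.
  have [C [iC sCA <-]] := mrank_basis (contraction M F) A.
  move: iC; rewrite inE => /eqP <-.
  by rewrite mrankS // setSU // imsetS.
have [C [iC sCF cC]] := mrank_basis M F.
have [D [iD sCD sDA <-]] := indep_extend iC (subset_trans sCF (subsetUr (val @:
  A) F)).
pose B : {set contrI F} := val @^-1: D.
have DF : D :&: F = C.
  apply/eqP; rewrite eq_sym eqEcard subsetI sCD sCF cC /=.
  by rewrite card_indep_mrank ?subsetIr // (indepS _ iD) ?subsetIl.
have eD : D = val @: B :|: C.
  apply/setP=> x; rewrite inE -DF inE; apply/idP/idP => [xD|].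
    rewrite xD /=; have [xF|xF] := boolP (x \in F); first by rewrite orbT.
    by rewrite orbF; apply/imsetP; exists (Sub x xF); rewrite ?inE.
  by case/orP=> [/imsetP[y]|/andP[]//]; rewrite inE => yD ->.
rewrite eD imset_val_disjointU // -cC leq_add2r card_indep_mrank //.
  by rewrite [indep _](erefl (contr_indep M F)) (contr_indepE iC) // -eD.
apply/subsetP=> y; rewrite inE => yD; have := subsetP sDA _ yD.
by rewrite inE (negbTE (valP y)) orbF => /imsetP[z zA /val_inj ->].
Qed.

Hypothesis fF : flat M F.

Lemma flat_loc (A : {set locI F}) : flat (localization M F) A = flat M (val @:
  A).
Proof.
apply/forallP/forallP=> fA x; apply/implyP=> xA; last first.
  rewrite !mrank_loc imsetU1; apply: (implyP (fA _)).
  by rewrite (mem_imset _ _ val_inj).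
have sAF : val @: A \subset F by apply/subsetP=> _ /imsetP[y _ ->]; exact: valP.
have [xF|xF] := boolP (x \in F).
  have := implyP (fA (Sub x xF)); rewrite !mrank_loc imsetU1 SubK; apply.
  by apply: contra xA => xA; apply/imsetP; exists (Sub x xF).
rewrite ltnNge -mem_mcl; apply: contra xF => xF; rewrite -(flat_mcl fF).
exact: (subsetP (mclS M sAF)).
Qed.

Lemma flat_contr (A : {set contrI F}) :
  flat (contraction M F) A = flat M (val @: A :|: F).
Proof.
apply/forallP/forallP=> fA x; apply/implyP=> xA.
  move: xA; rewrite inE negb_or => /andP[xA xF].
  have := implyP (fA (Sub x xF)); rewrite -(ltn_add2r (mrank M F)) !mrank_contr.
  rewrite imsetU1 SubK -setUA; apply.
  by apply: contra xA => xA; apply/imsetP; exists (Sub x xF).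
rewrite -(ltn_add2r (mrank M F)) !mrank_contr imsetU1 -setUA.
apply: (implyP (fA _)).
by rewrite inE negb_or (mem_imset _ _ val_inj) xA (valP x).
Qed.

Lemma loopless_loc : loopless M -> loopless (localization M F).
Proof.
move/forallP=> lM; apply/forallP=> x.
by rewrite indep_mrank mrank_loc imset_set1 cards1 -(cards1 (val x))
  -indep_mrank.
Qed.

Lemma loopless_contr : loopless (contraction M F).
Proof.
apply/forallP=> x; rewrite indep_mrank eqn_leq mrank_le_card /= cards1.
rewrite -(ltn_add2r (mrank M F)) mrank_contr imset_set1.
exact: (implyP (forallP fF _) (valP x)).
Qed.

Lemma rk_loc : rk (localization M F) = mrank M F.
Proof.
rewrite /rk mrank_loc; congr mrank; apply/setP=> x.
apply/imsetP/idP=> [[y _ ->]|xF]; first exact: valP.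
by exists (Sub x xF).
Qed.

Lemma imset_val_contrT : val @: [set: contrI F] :|: F = [set: I].
Proof.
apply/setP=> x; rewrite !inE; have [xF|xF] := boolP (x \in F).
  by rewrite orbT.
by apply/orP; left; apply/imsetP; exists (Sub x xF).
Qed.

Lemma rk_contr : (rk (contraction M F) + mrank M F)%N = rk M.
Proof. by rewrite /rk mrank_contr imset_val_contrT. Qed.

End LocContr.

(** * Kazhdan-Lusztig-Stanley polynomials of posets of sets *)

Section Reversal.

Variable R : nzRingType.
Implicit Types P Q : {poly R}.

(** The formula of [reverse] over any ring, since it is also applied to the polynomials over [algC]
    obtained by evaluating characters. Coefficients above degree [n] are lost, whence the size
    bounds in [revpM]. *)
Definition revp n P : {poly R} := \poly_(k < n.+1) P`_(n - k).

Lemma coef_revp n P k : (revp n P)`_k = if (k <= n)%N then P`_(n - k) else 0.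
Proof. by rewrite coef_poly ltnS. Qed.

Lemma revp_is_zmod_morphism n : zmod_morphism (revp n).
Proof.
by move=> P Q; apply/polyP=> k; rewrite coefB !coef_revp; case: ifP;
  rewrite ?coefB ?subr0.
Qed.
HB.instance Definition _ n :=
  GRing.isZmodMorphism.Build {poly R} {poly R} (revp n) (revp_is_zmod_morphism
    n).

Lemma revpZ n a P : revp n (a *: P) = a *: revp n P.
Proof.
by apply/polyP=> k; rewrite coefZ !coef_revp; case: ifP; rewrite ?coefZ ?mulr0.
Qed.

Lemma revpXn n i : (i <= n)%N -> revp n 'X^i = 'X^(n - i).
Proof.
move=> le_in; apply/polyP=> k; rewrite coef_revp !coefXn.
case: leqP => [le_kn|lt_nk]; last by have -> : (k == n - i)%N = false by lia.
by have -> : (n - k == i)%N = (k == n - i)%N by lia.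
Qed.

Lemma poly_sum_wide n P : (size P <= n)%N -> P = \sum_(i < n) P`_i *: 'X^i.
Proof. move=> sP; rewrite -poly_def; apply/polyP=> k; rewrite coef_poly.
by case: ltnP => // le_nk; rewrite nth_default // (leq_trans sP). Qed.

End Reversal.

Lemma revpM (R : comNzRingType) m n (P Q : {poly R}) :
    (size P <= m.+1)%N -> (size Q <= n.+1)%N ->
  revp (m + n) (P * Q) = revp m P * revp n Q.
Proof.
move=> /poly_sum_wide-> /poly_sum_wide->.
rewrite mulr_suml !raddf_sum mulr_suml; apply: eq_bigr => i _ /=.
rewrite mulr_sumr !raddf_sum mulr_sumr; apply: eq_bigr => j _ /=.
rewrite -scalerAl -scalerAr -exprD !revpZ -scalerAl -scalerAr !revpXn;
  try by case: i j => i li [j lj] /=; lia.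
by rewrite -exprD; congr (_ *: (_ *: 'X^_)); case: i j => i li [j lj] /=; lia.
Qed.

(** * Moebius functions of families of sets ordered by inclusion *)

Section Mobius.

Variables (R : numDomainType) (I : finType) (S : {set {set I}}).
Implicit Types A B E F G : {set I}.

(** [n] is fuel. The recursion passes to proper subsets of [G], so [#|G|] is enough. *)
Fixpoint mobius_rec n F G : R :=
  if F == G then 1 else
  if n is m.+1 then
    - \sum_(E in S | (F \subset E) && (E \proper G)) mobius_rec m F E
  else 0.

Definition mobius F G : R := mobius_rec #|G| F G.

Lemma mobius_rec_stable n m F G :
  (#|G| <= n)%N -> (#|G| <= m)%N -> mobius_rec n F G = mobius_rec m F G.
Proof.
elim: n m G => [|n IHn] [|m] G //=; rewrite ?leqn0 ?cards_eq0.
- move=> /eqP-> _; case: eqP => // _; rewrite big_pred0 ?oppr0 // => E.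
  by rewrite properE [_ \subset set0]subset0; case: eqP => [->|];
    rewrite ?sub0set ?andbF.
- move=> _ /eqP->; case: eqP => // _; rewrite big_pred0 ?oppr0 // => E.
  by rewrite properE [_ \subset set0]subset0; case: eqP => [->|];
    rewrite ?sub0set ?andbF.
move=> leGn leGm; case: eqP => // _; congr (- _);
  apply: eq_bigr => E /and3P[_ _ /proper_card ltEG].
by apply: IHn; rewrite -ltnS (leq_trans ltEG).
Qed.

Lemma mobiusxx F : mobius F F = 1.
Proof. by rewrite /mobius; case: #|F| => [|n] /=; rewrite eqxx. Qed.

Lemma mobiusE F G : F != G ->
  mobius F G = - \sum_(E in S | (F \subset E) && (E \proper G)) mobius F E.
Proof.
move=> neFG; rewrite /mobius (@mobius_rec_stable _ #|G|.+1) //= (negbTE neFG).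
congr (- _); apply: eq_bigr => E /and3P[_ _ /proper_card ltEG].
by apply: mobius_rec_stable => //; apply: ltnW.
Qed.

Lemma sum_mobiusl F G : G \in S -> F \subset G ->
  \sum_(E in S | (F \subset E) && (E \subset G)) mobius F E = (F == G)%:R.
Proof.
move=> GS sFG; rewrite (bigD1 G) /=; last by rewrite GS sFG subxx.
under eq_bigl => E do rewrite -!andbA [(E \subset G) && _]andbC -properEneq.
have [<-|neFG] := eqVneq F G; last by rewrite mobiusE // addNr.
rewrite mobiusxx big_pred0 ?addr0 // => E.
by rewrite properE; case: (F \subset E); rewrite ?andbF.
Qed.

(** The relation at [G] gives [a G] from the values at smaller sets. This serves for the signed
    Orlik-Solomon traces and for the transfer between isomorphic intervals. *)
Lemma mobius_unique F (a : {set I} -> R) :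
    (forall G, G \in S -> F \subset G ->
      \sum_(E in S | (F \subset E) && (E \subset G)) a E = (F == G)%:R) ->
  forall G, G \in S -> F \subset G -> a G = mobius F G.
Proof.
move=> sum_a G; have [n] := ubnP #|G|.
elim: n G => // n IHn G leGn GS sFG.
have := sum_a G GS sFG; rewrite -(sum_mobiusl GS sFG).
rewrite (bigD1 G) /= ?GS ?sFG ?subxx // [in RHS](bigD1 G) /= ?GS ?sFG ?subxx //.
rewrite (eq_bigr (mobius F)) => [/addIr // | E].
case/andP=> /and3P[ES sFE sEG] neEG; apply: IHn => //.
by rewrite -ltnS; apply: leq_trans leGn;
  rewrite ltnS proper_card // properEneq neEG.
Qed.

(** [sum_mobiusl] says that the Moebius matrix is a left inverse of the zeta matrix of [S]; both
    being square, it is also a right inverse. *)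
Lemma sum_mobiusr F G : F \in S -> G \in S -> F \subset G ->
  \sum_(E in S | (F \subset E) && (E \subset G)) mobius E G = (F == G)%:R.
Proof.
move=> FS GS sFG; pose el (i : 'I_#|S|) := enum_val i.
pose Mu : 'M[R]_#|S| := \matrix_(i, j) if el i \subset el j then mobius (el i)
  (el j) else 0.
pose Ze : 'M[R]_#|S| := \matrix_(i, j) (el i \subset el j)%:R.
have elS i : el i \in S by apply: enum_valP.
have mu_ze : Mu *m Ze = 1%:M.
  apply/matrixP=> i j; rewrite !mxE.
  transitivity (\sum_(E in S | (el i \subset E) && (E \subset el j)) mobius (el
    i) E).
    rewrite [RHS]big_mkcondr [RHS]big_enum_val; apply: eq_bigr => k _.
    by rewrite !mxE -/(el k); do 2 case: (_ \subset _);
      rewrite ?mulr1 ?mulr0 ?mul0r.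
  have [sij|nsij] := boolP (el i \subset el j).
    by rewrite sum_mobiusl // (inj_eq enum_val_inj).
  rewrite big_pred0 => [|E].
    by case: eqP nsij => // ->; rewrite subxx.
  by apply: contraNF nsij => /and3P[_]; apply: subset_trans.
have := mulmx1C mu_ze => /matrixP/(_ (enum_rank_in FS F) (enum_rank_in GS G)).
rewrite !mxE -(inj_eq enum_val_inj) !enum_rankK_in // => <-.
rewrite big_mkcondr big_enum_val; apply: eq_bigr => k _.
rewrite !mxE /el !enum_rankK_in //.
by do 2 case: (_ \subset _); rewrite ?mul1r ?mulr0 ?mul0r.
Qed.

End Mobius.

(** * Kernels and the Kazhdan-Lusztig-Stanley recursion *)

Section KazhdanLusztigStanley.

Variables (R : numDomainType) (I : finType) (S : {set {set I}}).
Variable r : {set I} -> nat.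
Implicit Types A B E F G : {set I}.

(* Stanley's kernel: the characteristic polynomial of the interval [F, G] of S,
   graded by r. *)
Definition kernel F G : {poly R} :=
  \sum_(E in S | (F \subset E) && (E \subset G)) mobius R S F E *: 'X^(r G - r
    E).

(** [n] is fuel, and [#|~: F|] is enough. For [m = r setT - r F] positive, the truncation keeps the
    degrees [k] with [2 k < m]. There the reversed polynomial has no coefficient, so the recursion
    forces the value. *)
Fixpoint kls_rec n F : {poly R} :=
  if F == setT then 1 else
  if n is m.+1 then
    \poly_(k < ((r setT - r F).-1)./2.+1)
      - (\sum_(G in S | F \proper G) kernel F G * kls_rec m G)`_k
  else 0.

Definition kls F := kls_rec #|~: F| F.

Lemma kls_rec_stable n m F :
  (#|~: F| <= n)%N -> (#|~: F| <= m)%N -> kls_rec n F = kls_rec m F.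
Proof.
have maxF E : (#|~: E| <= 0)%N -> E == setT.
  by rewrite leqn0 cards_eq0 => /eqP E0; rewrite -[E]setCK E0 setC0.
elim: n m F => [|n IHn] [|m] F //=; try by move=> /maxF-> // /maxF->.
- by move=> _ /maxF->.
move=> leFn leFm; case: eqP => // _; apply: eq_poly => k _;
  congr (- nth 0 (polyseq _) _).
apply: eq_bigr => G /andP[_ ltFG]; congr (_ * _).
have ltGF: (#|~: G| < #|~: F|)%N by rewrite proper_card // properC.
by apply: IHn; rewrite -ltnS (leq_trans ltGF).
Qed.

Lemma klsT : kls setT = 1.
Proof. by rewrite /kls; case: #|_| => [|n] /=; rewrite eqxx. Qed.

Lemma klsE F : F != setT ->
  kls F = \poly_(k < ((r setT - r F).-1)./2.+1)
            - (\sum_(G in S | F \proper G) kernel F G * kls G)`_k.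
Proof.
move=> neFT; rewrite /kls (@kls_rec_stable _ #|~: F|.+1) //= (negbTE neFT).
apply: eq_poly => k _; congr (- nth 0 (polyseq _) _).
apply: eq_bigr => G /andP[_ ltFG]; congr (_ * _); apply: kls_rec_stable => //.
by apply/ltnW/proper_card; rewrite properC.
Qed.

Lemma size_kls F : (size (kls F) <= ((r setT - r F).-1)./2.+1)%N.
Proof.
have [->|neFT] := eqVneq F setT; first by rewrite klsT size_poly1.
by rewrite klsE // size_poly.
Qed.

Lemma size_kls_wide F : (size (kls F) <= (r setT - r F).+1)%N.
Proof. by apply: leq_trans (size_kls F) _; lia. Qed.

Lemma kernelxx F : F \in S -> kernel F F = 1.
Proof.
move=> FS; rewrite /kernel (big_pred1 F) => [|E] /=.
  by rewrite mobiusxx scale1r subnn expr0.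
rewrite -eqEsubset eq_sym andbC; case: eqP => //= ->; exact: FS.
Qed.

Hypothesis r_mono : {in S &, forall F G, F \proper G -> (r F < r G)%N}.

Lemma rank_le F G : F \in S -> G \in S -> F \subset G -> (r F <= r G)%N.
Proof.
move=> FS GS; rewrite subEproper => /predU1P[->|ltFG] //.
by rewrite ltnW // r_mono.
Qed.

Lemma size_kernel F G : F \in S -> (size (kernel F G) <= (r G - r F).+1)%N.
Proof.
move=> FS; apply: (leq_trans (size_sum _ _ _));
  apply/bigmax_leqP=> E /and3P[ES sFE sEG].
apply: leq_trans (size_scale_leq _ _) _; rewrite size_polyXn ltnS leq_sub2l //.
exact: rank_le.
Qed.

Lemma revp_kernel F G : F \in S -> G \in S ->
  revp (r G - r F) (kernel F G) =
    \sum_(E in S | (F \subset E) && (E \subset G)) mobius R S F E *: 'X^(r E -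
      r F).
Proof.
move=> FS GS; rewrite /kernel raddf_sum;
  apply: eq_bigr => E /and3P[ES sFE sEG] /=.
have leFE := rank_le FS ES sFE; have leEG := rank_le ES GS sEG.
by rewrite revpZ revpXn; [congr (_ *: 'X^_) |]; lia.
Qed.

(** Once both kernels are expanded, the sum runs over [A \subset E \subset B]. Summing over [E]
    leaves only [A = B] by [sum_mobiusr], with a monomial independent of [A]; summing over [A] then
    concludes by [sum_mobiusl]. *)
Lemma kernel_inv F G : F \in S -> G \in S -> F \subset G ->
  \sum_(E in S | (F \subset E) && (E \subset G))
      revp (r E - r F) (kernel F E) * kernel E G = (F == G)%:R.
Proof.
move=> FS GS sFG.
pose t A B := mobius R S F A *: 'X^(r A - r F) * 'X^(r G - r B).
transitivity (\sum_(A in S | (F \subset A) && (A \subset G))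
    \sum_(B in S | (A \subset B) && (B \subset G))
    \sum_(E in S | (A \subset E) && (E \subset B)) mobius R S E B *: t A B).
  under eq_bigr => E /and3P[ES sFE sEG].
    rewrite revp_kernel // mulr_suml.
    under eq_bigr => A _.
      rewrite /kernel mulr_sumr.
      under eq_bigr => B _ do rewrite -scalerAr -/(t A B).
      over.
    over.
  rewrite (exchange_big_dep (fun A => (A \in S) && ((F \subset A) && (A \subset
    G)))) /=; last first.
    move=> E A /and3P[ES sFE sEG] /and3P[AS sFA sAE].
    by rewrite AS sFA (subset_trans sAE).
  apply: eq_bigr => A /and3P[AS sFA sAG].
  rewrite (exchange_big_dep (fun B => (B \in S) && ((A \subset B) && (B \subset
    G)))) /=; last first.
    move=> E B /andP[_ /and3P[_ _ sAE]] /and3P[-> sEB ->].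
    by rewrite (subset_trans sAE).
  apply: eq_bigr => B /and3P[BS sAB sBG]; apply: eq_bigl => E.
  rewrite AS sFA BS sBG /= !andbT; case: (E \in S) => //=.
  case sAE: (A \subset E); last by rewrite !andbF.
  case sEB: (E \subset B); last by rewrite !andbF.
  by rewrite (subset_trans sFA sAE) (subset_trans sEB sBG).
under eq_bigr => A /and3P[AS sFA sAG].
  under eq_bigr => B /and3P[BS sAB sBG] do rewrite -scaler_suml sum_mobiusr //.
  rewrite (bigD1 A) /= ?AS ?subxx // eqxx scale1r big1 ?addr0 => [|B];
    last first.
    by case/andP=> _ neBA; rewrite eq_sym (negbTE neBA) scale0r.
  rewrite /t -scalerAl -exprD.
  have -> : (r A - r F + (r G - r A) = r G - r F)%N.
    by have := rank_le FS AS sFA; have := rank_le AS GS sAG; lia.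
  over.
rewrite -scaler_suml sum_mobiusl //; case: eqP => [->|_];
  last by rewrite scale0r.
by rewrite subnn scale1r.
Qed.

Hypothesis S_top : [set: I] \in S.

Lemma kls_rev F : F \in S ->
  revp (r setT - r F) (kls F) = \sum_(G in S | F \subset G) kernel F G * kls G.
Proof.
have [n] := ubnP #|~: F|; elim: n F => // n IHn F leFn FS.
have [->|neFT] := eqVneq F setT.
  rewrite subnn klsT (big_pred1 setT) => [|E /=]; last first.
    by rewrite subTset; case: eqP => [->|_]; rewrite ?S_top ?andbF.
  by rewrite kernelxx // klsT mulr1 -[1](expr0 'X) revpXn.
set X := \sum_(G in S | F \proper G) kernel F G * kls G.
pose m := (r setT - r F)%N.
have m_gt0 : (0 < m)%N by rewrite subn_gt0 r_mono // properT.
have leT G : G \in S -> (r G <= r setT)%N.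
  by move=> GS; rewrite rank_le // subsetT.
(* Hence the lower half of [- X] solves [revp m (kls F) = kls F + X]. *)
have X_anti : revp m X = - X.
  rewrite /X raddf_sum /=.
  transitivity (\sum_(G in S | F \proper G) \sum_(H in S | G \subset H)
      revp (r G - r F) (kernel F G) * kernel G H * kls H).
    apply: eq_bigr => G /andP[GS ltFG].
    have -> : m = ((r G - r F) + (r setT - r G))%N.
      by have := leT G GS; have := r_mono FS GS ltFG; rewrite /m; lia.
    rewrite revpM ?size_kernel ?size_kls_wide // IHn //; last first.
      by rewrite -ltnS; apply: leq_trans leFn;
        rewrite ltnS proper_card // properC.
    by rewrite mulr_sumr; under eq_bigr => H _ do rewrite mulrA.
  rewrite (exchange_big_dep (fun H => (H \in S) && (F \proper H))) /=;
    last first.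
    by move=> G H /andP[_ ltFG] /andP[-> /(proper_sub_trans ltFG)->].
  (* For fixed [H], the relation [kernel_inv] on [[F, H]] has the term [kernel F H] at [G = F], so
     the other terms add up to its opposite. *)
  rewrite -sumrN; apply: eq_bigr => H /andP[HS ltFH].
  rewrite -mulr_suml -mulNr; congr (_ * _).
  have := kernel_inv FS HS (proper_sub ltFH).
  rewrite (negbTE (proper_neq ltFH)) (bigD1 F) /= ?FS ?subxx ?proper_sub //.
  rewrite kernelxx // subnn -[1](expr0 'X) revpXn // subnn expr0 mul1r.
  move/eqP; rewrite addrC addr_eq0 => /eqP <-; apply: eq_bigl => G.
  rewrite HS properEneq [G == F]eq_sym.
  by case: (G \in S); case: (F == G); case: (F \subset G); case: (G \subset H).
have -> : \sum_(G in S | F \subset G) kernel F G * kls G = kls F + X.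
  rewrite (bigD1 F) /= ?FS ?subxx // kernelxx // mul1r; congr (_ + _).
  by apply: eq_bigl => G;
    rewrite properEneq [G == F]eq_sym -andbA [(F \subset G) && _]andbC.
have X_coef k : (k <= m)%N -> X`_(m - k) = - X`_k.
  by move=> le_km; rewrite -coefN -X_anti coef_revp le_km.
have X_big k : (m < k)%N -> X`_k = 0.
  move=> lt_mk; apply/eqP;
    rewrite -oppr_eq0 -coefN -X_anti coef_revp leqNgt lt_mk.
  by [].
rewrite -/m klsE // -/X -/m; apply/polyP=> k;
  rewrite coef_revp coefD !coef_poly.
have [le_km|lt_mk] := leqP k m; last first.
  by rewrite X_big // oppr0 if_same addr0.
have [lt1|le1] := ltnP (m - k) (m.-1)./2.+1.
  by rewrite ifF ?add0r ?X_coef ?opprK //; apply/negbTE; lia.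
have [lt2|le2] := ltnP k (m.-1)./2.+1; first by rewrite addNr.
(* Middle degree of an even [m]: it lies in neither half, and antisymmetry makes the coefficient of
   [X] equal to its opposite, hence 0 in characteristic 0. *)
have eqk : (m - k)%N = k by lia.
have := X_coef k le_km; rewrite eqk => /eqP;
  rewrite -addr_eq0 -mulr2n mulrn_eq0 /=.
by move/eqP->; rewrite addr0.
Qed.

End KazhdanLusztigStanley.

(** * Transfer along isomorphisms onto convex subfamilies *)

Section Transfer.

Variables (R : numDomainType) (I I' : finType).
Variables (S : {set {set I}}) (S' : {set {set I'}}).
Variables (r : {set I} -> nat) (r' : {set I'} -> nat).
Variable psi : {set I'} -> {set I}.
Hypothesis psiS : {in S', forall A, psi A \in S}.
Hypothesis psi_le : {in S' &, forall A B, (psi A \subset psi B) = (A \subset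
  B)}.
Hypothesis psi_convex : {in S' & S', forall A B, {in S, forall E : {set I},
  psi A \subset E -> E \subset psi B -> exists2 C, C \in S' & E = psi C}}.
Hypothesis psi_r : {in S' &, forall A B : {set I'}, A \subset B ->
  (r (psi B) - r (psi A) = r' B - r' A)%N}.

Lemma psi_inj : {in S' &, injective psi}.
Proof.
move=> A B AS BS eAB; apply/eqP.
by rewrite eqEsubset -(psi_le AS BS) -(psi_le BS AS) eAB subxx.
Qed.

(** By convexity no set between [psi A] and [psi B] is missed. The predicate [P] lets an endpoint be
    left out, as in the recursion for [kls]. *)
Lemma big_interval (V : nmodType) A B (P : pred {set I}) (f : {set I} -> V) :
    A \in S' -> B \in S' ->
  \sum_(E in S | (psi A \subset E) && (E \subset psi B) && P E) f E =
  \sum_(C in S' | (A \subset C) && (C \subset B) && P (psi C)) f (psi C).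
Proof.
move=> AS BS; pose D := [set C in S' | (A \subset C) && (C \subset B) && P (psi
  C)].
transitivity (\sum_(E in psi @: D) f E); last first.
  rewrite big_imset => [|C C' /= /setIdP[CS _] /setIdP[C'S _]];
    last exact: psi_inj.
  by apply: eq_bigl => C; rewrite inE.
apply: eq_bigl => E; apply/idP/imsetP=> [|[C]].
  case/andP=> ES /andP[/andP[sAE sEB] PE].
  have [C CS eE] := psi_convex AS BS ES sAE sEB.
  by exists C; rewrite // inE CS -!psi_le // -eE sAE sEB.
rewrite inE => /andP[CS /andP[/andP[sAC sCB] PC]] ->.
by rewrite psiS // !psi_le // sAC sCB.
Qed.

Lemma big_interval_full (V : nmodType) A B (f : {set I} -> V) :
    A \in S' -> B \in S' ->
  \sum_(E in S | (psi A \subset E) && (E \subset psi B)) f E =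
  \sum_(C in S' | (A \subset C) && (C \subset B)) f (psi C).
Proof.
move=> AS BS; have := big_interval predT f AS BS; rewrite /=.
under eq_bigl do rewrite andbT; move=> ->.
by apply: eq_bigl => C; rewrite andbT.
Qed.

Lemma mobius_transfer : {in S' &, forall A B : {set I'}, A \subset B ->
  mobius R S (psi A) (psi B) = mobius R S' A B}.
Proof.
move=> A B AS BS sAB.
apply: (mobius_unique (S := S') (a := fun C => mobius R S (psi A) (psi C))) =>
  // C CS sAC.
rewrite -(big_interval_full (mobius R S (psi A)) AS CS).
by rewrite sum_mobiusl ?psiS ?psi_le // (inj_in_eq psi_inj).
Qed.

Lemma kernel_transfer : {in S' &, forall A B : {set I'}, A \subset B ->
  kernel R S r (psi A) (psi B) = kernel R S' r' A B}.
Proof.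
move=> A B AS BS sAB; rewrite /kernel.
rewrite (big_interval_full (fun E => mobius R S (psi A) E *: 'X^(r (psi B) - r
  E)) AS BS).
by apply: eq_bigr => C /and3P[CS sAC sCB]; rewrite mobius_transfer // psi_r.
Qed.

Hypothesis S'_top : [set: I'] \in S'.
Hypothesis psi_top : psi setT = setT.

(** Only the members of [S] above [psi A] matter. As [psi] preserves the top, convexity makes them
    images of members of [S'], even if [psi] is not onto, as for a contraction. *)
Lemma kls_transfer : {in S', forall A, kls R S r (psi A) = kls R S' r' A}.
Proof.
move=> A; have [n] := ubnP #|~: A|; elim: n A => // n IHn A leAn AS.
have [->|neAT] := eqVneq A setT; first by rewrite psi_top !klsT.
have neT : psi A != setT by rewrite -psi_top (inj_in_eq psi_inj).
rewrite !klsE // -psi_top psi_r ?subsetT //; apply: eq_poly => k _.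
congr (- nth 0 (polyseq _) _).
have := big_interval (fun E => psi A != E) (fun E => kernel R S r (psi A) E *
  kls R S r E) AS S'_top.
rewrite psi_top => big_eq.
transitivity (\sum_(E in S | (psi A \subset E) && (E \subset setT) && (psi A !=
  E))
    kernel R S r (psi A) E * kls R S r E).
  by apply: eq_bigl => E;
    rewrite subsetT andbT properEneq [(psi A != E) && _]andbC.
rewrite big_eq; apply: eq_big => [C|C /andP[CS /andP[/andP[sAC _] neAC]]].
  rewrite subsetT andbT properEneq [(A != C) && _]andbC; apply: andb_id2l => CS.
  by rewrite (inj_in_eq psi_inj).
rewrite kernel_transfer // IHn //.
have ltAC : A \proper C by rewrite properEneq sAC -(inj_in_eq psi_inj) ?neAC.
by rewrite -ltnS; apply: leq_trans leAn; rewrite ltnS proper_card // properC.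
Qed.

End Transfer.

(** * The Orlik-Solomon ideal *)

Section Words.

Variable I : finType.
Implicit Types (i j x : I) (s t u v c : seq I).

Lemma monomial_size_neq p s : size s != p -> monomial p s = 0.
Proof.
move=> ns; apply/rowP=> b; rewrite !mxE.
by case: eqP => // eb; rewrite -eb size_tuple eqxx in ns.
Qed.

Lemma monomial_delta p s : size s = p ->
  exists2 a : 'I_(nwords I p), word a = s :> seq I & monomial p s = delta_mx 0
    a.
Proof.
move=> /eqP ss; exists (enum_rank (Tuple ss));
  first by rewrite /word enum_rankK.
apply/rowP=> b; rewrite !mxE /= -(inj_eq enum_val_inj) enum_rankK.
by congr (_ _)%:R; apply/eqP/eqP=> [/val_inj|->].
Qed.

Lemma monomial_mx_inj p n (X Y : 'M[algC]_(nwords I p, n)) :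
    (forall s, size s = p -> monomial p s *m X = monomial p s *m Y) -> X = Y.
Proof.
move=> eXY; apply/row_matrixP=> a.
have [b eb eab] := @monomial_delta p (word a) (size_tuple _).
have -> : a = b by apply: enum_val_inj; apply: val_inj;
  rewrite -/(word a) -/(word b) /= eb.
by rewrite !rowE -eab; apply/eXY/size_tuple.
Qed.

Lemma monomial_submx p n m (X : 'M[algC]_(nwords I p, n)) (U : 'M_(m, n)) :
  (forall s, size s = p -> (monomial p s *m X <= U)%MS) -> (X <= U)%MS.
Proof.
move=> sXU; apply/row_subP=> a.
have [b eb eab] := @monomial_delta p (word a) (size_tuple _).
have -> : a = b by apply: enum_val_inj; apply: val_inj;
  rewrite -/(word a) -/(word b) /= eb.
by rewrite rowE -eab; apply/sXU/size_tuple.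
Qed.

(** Matrices act on row vectors from the right: this is the linear map given by [f] on the basis of
    words. *)
Definition word_lin p n (f : seq I -> 'rV[algC]_n) : 'M_(nwords I p, n) :=
  \matrix_(a < nwords I p) f (word a).

Lemma monomial_word_lin p n (f : seq I -> 'rV[algC]_n) s :
  size s = p -> monomial p s *m word_lin p f = f s.
Proof.
by move=> ss; have [a <- ->] := monomial_delta ss; rewrite -rowE rowK.
Qed.

Lemma boundary_rel_cons p u v x c :
  boundary_rel p u v (x :: c) =
    monomial p (u ++ c ++ v) - boundary_rel p (u ++ [:: x]) v c.
Proof.
rewrite /boundary_rel big_ord_recl /= expr0 scale1r drop0; congr (_ + _).
rewrite -sumrN; apply: eq_bigr => k _.
by rewrite /bump /= add1n exprS mulN1r scaleNr -!catA.
Qed.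

Lemma boundary_rel_nil p u v : boundary_rel p u v [::] = 0.
Proof. by rewrite /boundary_rel big_ord0. Qed.

(** The graded Leibniz rule; [u] and [v] are outer factors that are not differentiated. *)
Lemma boundary_rel_cat p u v s t :
  boundary_rel p u v (s ++ t) =
    boundary_rel p u (t ++ v) s + (-1) ^+ size s *: boundary_rel p (u ++ s) v t.
Proof.
elim: s u => [|x s IHs] u /=.
  by rewrite boundary_rel_nil add0r expr0 scale1r cats0.
rewrite !boundary_rel_cons IHs -catA opprD addrA; congr (_ + _).
by rewrite exprS mulN1r scaleNr -catA.
Qed.

(** The boundary squares to 0, between the factors [u] and [v]. For [x :: c] this reads [d (e_c - x
    d e_c) = d e_c - d e_c + x d (d e_c)]. *)
Lemma boundary_rel_twice p u v c :
  \sum_(k < size c) (-1) ^+ k *: boundary_rel p u v (take k c ++ drop k.+1 c) =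
    0.
Proof.
elim: c u => [|x c IHc] u; first by rewrite big_ord0.
rewrite big_ord_recl /= expr0 scale1r drop0.
under eq_bigr => k _.
  rewrite /bump /= add1n exprS mulN1r boundary_rel_cons scalerDr !scaleNr
    scalerN opprK.
  over.
by rewrite big_split /= IHc addr0 sumrN subrr.
Qed.

Definition boundary_mx p : 'M_(nwords I p.+1, nwords I p) :=
  word_lin p.+1 (boundary_rel p [::] [::]).

Definition letter_mx i p : 'M_(nwords I p, nwords I p.+1) :=
  word_lin p (fun s => monomial p.+1 (i :: s)).

Lemma monomial_boundary_mx p s :
  monomial p.+1 s *m boundary_mx p = boundary_rel p [::] [::] s.
Proof.
have [ss|ns] := eqVneq (size s) p.+1; first by rewrite monomial_word_lin.
rewrite monomial_size_neq // mul0mx /boundary_rel big1 // => k _.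
rewrite monomial_size_neq ?scaler0 //= cats0.
apply: contra ns; rewrite size_cat size_take size_drop ltn_ord => /eqP <-.
by apply/eqP; have := ltn_ord k; lia.
Qed.

Lemma monomial_letter_mx i p s :
  monomial p s *m letter_mx i p = monomial p.+1 (i :: s).
Proof.
have [ss|ns] := eqVneq (size s) p; first by rewrite monomial_word_lin.
by rewrite !monomial_size_neq ?mul0mx.
Qed.

Lemma boundary_rel_letter_mx i p u v c :
  boundary_rel p u v c *m letter_mx i p = boundary_rel p.+1 (i :: u) v c.
Proof.
rewrite /boundary_rel mulmx_suml; apply: eq_bigr => k _.
by rewrite -scalemxAl monomial_letter_mx.
Qed.

(** This is the Leibniz rule [d (e_i s) = s - e_i d s]. Since degree 0 has no outgoing boundary, it
    is treated separately in [letter_boundary_mx0]. *)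
Lemma letter_boundary_mx i p :
  letter_mx i p.+1 *m boundary_mx p.+1 + boundary_mx p *m letter_mx i p = 1%:M.
Proof.
apply: monomial_mx_inj => s ss; rewrite mulmxDr !mulmxA mulmx1.
rewrite monomial_letter_mx !monomial_boundary_mx boundary_rel_letter_mx.
by rewrite boundary_rel_cons /= cats0 subrK.
Qed.

Lemma letter_boundary_mx0 i : letter_mx i 0 *m boundary_mx 0 = 1%:M.
Proof.
apply: monomial_mx_inj => s /size0nil->; rewrite mulmxA mulmx1.
rewrite monomial_letter_mx monomial_boundary_mx boundary_rel_cons.
by rewrite boundary_rel_nil subr0.
Qed.

Definition select_mx (P : pred {set I}) p : 'M_(nwords I p) :=
  word_lin p (fun s => if P [set x in s] then monomial p s else 0).

Lemma monomial_select_mx (P : pred {set I}) p s :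
  monomial p s *m select_mx P p = if P [set x in s] then monomial p s else 0.
Proof.
have [ss|ns] := eqVneq (size s) p; first by rewrite monomial_word_lin.
by rewrite !monomial_size_neq ?mul0mx ?if_same.
Qed.

Lemma mul_select_mx (P Q : pred {set I}) p :
  select_mx P p *m select_mx Q p = select_mx (predI P Q) p.
Proof.
apply: monomial_mx_inj => s ss; rewrite mulmxA !monomial_select_mx /=.
by case: (P _); rewrite ?monomial_select_mx ?mul0mx.
Qed.

Lemma eq_select_mx (P Q : pred {set I}) p : P =1 Q -> select_mx P p = select_mx
  Q p.
Proof.
by move=> ePQ; apply: monomial_mx_inj => s _; rewrite !monomial_select_mx ePQ.
Qed.

Lemma select_mx_pred0 (P : pred {set I}) p : P =1 xpred0 -> select_mx P p = 0.
Proof.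
by move=> P0; apply: monomial_mx_inj => s _;
  rewrite monomial_select_mx P0 mulmx0.
Qed.

Lemma select_letter_mx (G : {set I}) i p : i \in G ->
  let Q := select_mx (fun A : {set I} => A \subset G) in
  Q p *m letter_mx i p = Q p *m letter_mx i p *m Q p.+1.
Proof.
move=> iG Q; apply: monomial_mx_inj => s ss; rewrite !mulmxA monomial_select_mx.
case: ifP => sG; rewrite ?mul0mx // monomial_letter_mx monomial_select_mx.
rewrite ifT //; apply/subsetP=> x; rewrite !inE => /predU1P[->|xs] //.
by apply: (subsetP sG); rewrite inE.
Qed.

Lemma select_boundary_mx (G : {set I}) p :
  let Q := select_mx (fun A : {set I} => A \subset G) in
  Q p.+1 *m boundary_mx p = Q p.+1 *m boundary_mx p *m Q p.
Proof.
move=> Q; apply: monomial_mx_inj => s ss; rewrite !mulmxA monomial_select_mx.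
case: ifP => sG; rewrite ?mul0mx // monomial_boundary_mx /boundary_rel
  mulmx_suml.
apply: eq_bigr => k _; rewrite -scalemxAl monomial_select_mx ifT //.
apply/subsetP=> x; rewrite inE /= cats0 mem_cat => xs; apply: (subsetP sG).
by rewrite inE; case/orP: xs => [/mem_take|/mem_drop].
Qed.

End Words.

(** * Stability of the Orlik-Solomon ideal and the monomials it contains *)

Section Ideal.

Variables (I : finType) (M : matroid I).
Implicit Types (i j x : I) (s t u v c : seq I) (A B : {set I}).

(** The length bounds in [os_ideal] lose nothing: a monomial whose word does not have length [p] is
    0, so longer factors give no relation. *)
Lemma os_ideal_square p u v i : (monomial p (u ++ [:: i;
  i] ++ v) <= os_ideal M p)%MS.
Proof.
have [ss|ns] := eqVneq (size (u ++ [:: i; i] ++ v)) p; last first.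
  by rewrite monomial_size_neq // sub0mx.
have su : (size u <= p)%N by rewrite -ss size_cat leq_addr.
have sv : (size v <= p)%N by rewrite -ss !size_cat; lia.
apply: (sumsmx_sup (Bseq su)) => //; apply: (sumsmx_sup (Bseq sv)) => //.
apply: submx_trans (addsmxSl _ _); apply: submx_trans (addsmxSl _ _).
by apply: (sumsmx_sup i) => //; rewrite genmxE.
Qed.

Lemma os_ideal_swap p u v i j :
  ((monomial p (u ++ [:: i; j] ++ v) + monomial p (u ++ [:: j; i] ++ v))%R
     <= os_ideal M p)%MS.
Proof.
have [ss|ns] := eqVneq (size (u ++ [:: i; j] ++ v)) p; last first.
  rewrite monomial_size_neq // monomial_size_neq ?add0r ?sub0mx //.
  by move: ns; rewrite !size_cat.
have su : (size u <= p)%N by rewrite -ss size_cat leq_addr.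
have sv : (size v <= p)%N by rewrite -ss !size_cat; lia.
apply: (sumsmx_sup (Bseq su)) => //; apply: (sumsmx_sup (Bseq sv)) => //.
apply: submx_trans (addsmxSl _ _); apply: submx_trans (addsmxSr _ _).
by apply: (sumsmx_sup i) => //; apply: (sumsmx_sup j) => //; rewrite genmxE.
Qed.

Lemma os_ideal_circuit p u v c :
  circuit_word M c -> (boundary_rel p u v c <= os_ideal M p)%MS.
Proof.
move=> Cc; have [ss|ns] := eqVneq (size u + (size c).-1 + size v)%N p;
  last first.
  rewrite /boundary_rel summx_sub // => k _;
    rewrite monomial_size_neq ?scaler0 ?sub0mx //.
  apply: contra ns => /eqP <-; rewrite !size_cat size_take size_drop ltn_ord.
  by apply/eqP; have := ltn_ord k; lia.
have su : (size u <= p)%N by rewrite -ss; lia.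
have sv : (size v <= p)%N by rewrite -ss; lia.
have sc : (size c <= p.+1)%N by rewrite -ss; lia.
apply: (sumsmx_sup (Bseq su)) => //; apply: (sumsmx_sup (Bseq sv)) => //.
apply: submx_trans (addsmxSr _ _).
by apply: (sumsmx_sup (Bseq sc)) => //; rewrite genmxE.
Qed.

Lemma os_ideal_mul_sub p n m (X : 'M_(nwords I p, n)) (Y : 'M_(m, n)) :
    (forall u v i, (monomial p (u ++ [:: i; i] ++ v) *m X <= Y)%MS) ->
    (forall u v i j, ((monomial p (u ++ [:: i; j] ++ v)
       + monomial p (u ++ [:: j; i] ++ v))%R *m X <= Y)%MS) ->
    (forall u v c, circuit_word M c -> (boundary_rel p u v c *m X <= Y)%MS) ->
  (os_ideal M p *m X <= Y)%MS.
Proof.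
move=> sqY swY circY.
rewrite /os_ideal sumsmxMr_gen; apply/sumsmx_subP=> u _; rewrite genmxE.
rewrite sumsmxMr_gen; apply/sumsmx_subP=> v _; rewrite genmxE.
rewrite addsmxMr addsmx_sub addsmxMr addsmx_sub -andbA; apply/and3P; split.
- rewrite sumsmxMr_gen; apply/sumsmx_subP=> i _; rewrite genmxE.
  by rewrite (eqmxMr _ (genmxE _)).
- rewrite sumsmxMr_gen; apply/sumsmx_subP=> i _; rewrite genmxE.
  rewrite sumsmxMr_gen; apply/sumsmx_subP=> j _; rewrite genmxE.
  by rewrite (eqmxMr _ (genmxE _)).
rewrite sumsmxMr_gen; apply/sumsmx_subP=> c Cc;
  rewrite genmxE (eqmxMr _ (genmxE _)).
exact: circY.
Qed.

(** By the Leibniz rule the boundary of a relation has three pieces. Differentiating [u] or [v]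
    gives a combination of relations of the same kind. The middle piece vanishes: directly for
    squares and anticommutators, and by [boundary_rel_twice] for circuits. *)
Lemma os_ideal_boundary p : (os_ideal M p.+1 *m boundary_mx I p <= os_ideal M
  p)%MS.
Proof.
have leib u w v : monomial p.+1 (u ++ w ++ v) *m boundary_mx I p =
    boundary_rel p [::] (w ++ v) u +
    (-1) ^+ size u *: (boundary_rel p u v w +
                       (-1) ^+ size w *: boundary_rel p (u ++ w) [::] v).
  by rewrite monomial_boundary_mx boundary_rel_cat boundary_rel_cat !cats0.
apply: os_ideal_mul_sub => [u v i | u v i j | u v c Cc].
- rewrite leib addmx_sub ?scalemx_sub //.
    rewrite /boundary_rel summx_sub // => k _; rewrite scalemx_sub //.
    exact: (os_ideal_square _ (take k u ++ drop k.+1 u)).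
  rewrite addmx_sub ?scalemx_sub //.
    by rewrite !boundary_rel_cons boundary_rel_nil subr0 -!catA /= subrr sub0mx.
  rewrite /boundary_rel summx_sub // => k _;
    rewrite scalemx_sub // cats0 -!catA.
  exact: (os_ideal_square _ u).
- rewrite mulmxDl !leib addrACA addmx_sub //.
    rewrite /boundary_rel -big_split summx_sub // => k _ /=.
    rewrite -scalerDr scalemx_sub //.
    exact: (os_ideal_swap _ (take k u ++ drop k.+1 u)).
  rewrite -scalerDr scalemx_sub // addrACA addmx_sub //.
    rewrite !boundary_rel_cons !boundary_rel_nil !subr0 -!catA /=.
    by rewrite addrA subrK subrr sub0mx.
  rewrite -scalerDr scalemx_sub // /boundary_rel -big_split summx_sub // => k _
    /=.
  rewrite -scalerDr scalemx_sub // !cats0 -!catA.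
  exact: (os_ideal_swap _ u).
rewrite {1}/boundary_rel mulmx_suml.
under eq_bigr => k _.
  rewrite -scalemxAl leib scalerDr [in X in _ + X]scalerDr [in X in _ +
    X]scalerDr.
  over.
rewrite !big_split /= !addmx_sub //.
- under eq_bigr => k _ do rewrite /boundary_rel scaler_sumr.
  rewrite exchange_big summx_sub // => j _ /=.
  under eq_bigr => k _ do rewrite scalerA mulrC -scalerA.
  rewrite -scaler_sumr scalemx_sub //=.
  have := os_ideal_circuit p (take j u ++ drop j.+1 u) v Cc;
    rewrite /boundary_rel.
  by [].
- under eq_bigr => k _ do rewrite scalerA mulrC -scalerA.
  by rewrite -scaler_sumr boundary_rel_twice scaler0 sub0mx.
have [c0|c_gt0] := posnP (size c).
  by rewrite big1 ?sub0mx // => k; have := ltn_ord k; rewrite {2}c0.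
(* Every term of the circuit boundary has [(size c).-1] letters, so the Leibniz sign in front of the
   derivative of [v] does not depend on [k]. *)
under eq_bigr => k _.
  rewrite size_cat size_take size_drop ltn_ord.
  have -> : (k + (size c - k.+1))%N = (size c).-1 by have := ltn_ord k; lia.
  rewrite /boundary_rel !scaler_sumr.
  over.
rewrite exchange_big summx_sub // => j _ /=.
pose e : algC := (-1) ^+ size u * ((-1) ^+ (size c).-1 * (-1) ^+ j).
pose v' := take j v ++ drop j.+1 v.
suff -> : \sum_(k < size c) (-1) ^+ k *: ((-1) ^+ size u *: ((-1) ^+ (size
  c).-1 *:
   ((-1) ^+ j *: monomial p ((u ++ take k c ++ drop k.+1 c) ++ v' ++ [::]))))
   = e *: boundary_rel p u v' c.
  by rewrite scalemx_sub // os_ideal_circuit.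
rewrite /boundary_rel scaler_sumr; apply: eq_bigr => k _.
by rewrite !scalerA cats0 -!catA; congr (_ *: _); rewrite /e; ring.
Qed.

Lemma os_ideal_letter i p : (os_ideal M p *m letter_mx i p <= os_ideal M
  p.+1)%MS.
Proof.
apply: os_ideal_mul_sub => [u v j | u v j k | u v c Cc].
- by rewrite monomial_letter_mx (os_ideal_square _ (i :: u)).
- by rewrite mulmxDl !monomial_letter_mx (os_ideal_swap _ (i :: u)).
by rewrite boundary_rel_letter_mx os_ideal_circuit.
Qed.

Definition closure_inv (P : pred {set I}) :=
  forall A B, A \subset B -> B \subset mcl M A -> P A = P B.

(* The ideal is graded by flats: all the words of a relation have the same
   closure. *)
Lemma os_ideal_select (P : pred {set I}) p :
  closure_inv P -> (os_ideal M p *m select_mx P p <= os_ideal M p)%MS.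
Proof.
move=> clP; apply: os_ideal_mul_sub => [u v i | u v i j | u v c Cc].
- by rewrite monomial_select_mx; case: ifP => _;
  rewrite ?sub0mx ?os_ideal_square.
- rewrite mulmxDl !monomial_select_mx.
  have -> : [set x in u ++ [:: j; i] ++ v] = [set x in u ++ [:: i; j] ++ v].
    by apply/setP=> x; rewrite !inE !mem_cat !inE; case: (x == i);
      case: (x == j).
  by case: ifP => _; rewrite ?addr0 ?sub0mx ?os_ideal_swap.
suff -> : boundary_rel p u v c *m select_mx P p =
    (if P [set x in u ++ c ++ v] then 1 else 0) *: boundary_rel p u v c.
  by case: ifP => _; rewrite ?scale1r ?scale0r ?sub0mx ?os_ideal_circuit.
rewrite /boundary_rel mulmx_suml scaler_sumr; apply: eq_bigr => k _.
rewrite -scalemxAl monomial_select_mx scalerA mulrC -scalerA; congr (_ *: _).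
suff -> : P [set x in u ++ (take k c ++ drop k.+1 c) ++ v] = P [set x in u ++ c
  ++ v].
  by case: ifP; rewrite ?scale1r ?scale0r.
have ltk := ltn_ord k; case/andP: Cc => uc /circuit_mcl Cc.
have /hasP[x0 _ _] : has predT c by rewrite has_predT (leq_ltn_trans _ ltk).
have ec : c = take k c ++ nth x0 c k :: drop k.+1 c by rewrite -drop_nth //
  cat_take_drop.
apply: clP; apply/subsetP=> x.
  rewrite !inE !mem_cat => /or3P[->|/orP[/mem_take->|/mem_drop->]|->];
    by rewrite ?orbT.
rewrite inE !mem_cat => xs.
have [xc|xc] := boolP (x \in c); last first.
  apply: (subsetP (sub_mcl _ _)); rewrite inE !mem_cat; move: xs.
  by rewrite (negbTE xc) /= => /orP[]->; rewrite ?orbT.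
have: x \in mcl M ([set y in c] :\ nth x0 c k).
  by apply: (subsetP (Cc _)); rewrite inE.
apply/subsetP/mclS/subsetP=> y; rewrite !inE !mem_cat => /andP[yk].
by rewrite {1}ec mem_cat inE (negbTE yk) /= => ->; rewrite orbT.
Qed.

(** Modulo the ideal, exchanging two adjacent letters only changes the sign of a monomial. Speaking
    of membership avoids keeping track of signs. *)
Lemma os_ideal_perm p s t : perm_eq s t ->
  (monomial p s <= os_ideal M p)%MS = (monomial p t <= os_ideal M p)%MS.
Proof.
pose mem w := (monomial p w <= os_ideal M p)%MS; rewrite -!/(mem _).
have swap u v i j : mem (u ++ [:: i; j] ++ v) = mem (u ++ [:: j; i] ++ v).
  have := os_ideal_swap p u v i j => sw; rewrite /mem.
  apply/idP/idP => m1.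
    by rewrite -[X in (X <= _)%MS](addKr (monomial p (u ++ [:: i;
      j] ++ v))) addmx_sub ?eqmx_opp.
  by rewrite -[X in (X <= _)%MS](addrK (monomial p (u ++ [:: j;
    i] ++ v))) addmx_sub ?eqmx_opp.
have move_letter u v w x : mem (u ++ x :: w ++ v) = mem (u ++ w ++ x :: v).
  elim: w u => //= y w IHw u.
  by rewrite (swap u (w ++ v) x y) /= -[in LHS]cat_rcons IHw cat_rcons.
suff: forall u, perm_eq s t -> mem (u ++ s) = mem (u ++ t) by move/(_ [::]).
elim: s t => [|x s IHs] t u.
  by move=> /perm_size/esym/size0nil->.
move=> pst; have xt : x \in t by rewrite -(perm_mem pst) mem_head.
case/splitPr: xt pst => t1 t2 pst.
rewrite -move_letter -!cat_rcons; apply: IHs.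
by move: pst; rewrite perm_sym -(cat1s x t2) perm_catCA /= perm_cons perm_sym.
Qed.

Lemma not_uniq_perm s : ~~ uniq s -> exists x t, perm_eq s (x :: x :: t).
Proof.
elim: s => //= y s IHs; rewrite negb_and negbK => /orP[ys|/IHs[x [t pst]]].
  by exists y, (rem y s); rewrite perm_cons perm_to_rem.
exists x, (y :: t); have := pst; rewrite -(perm_cons y) => /perm_trans; apply.
by rewrite -cat1s -(cat1s y t) (perm_catCA [:: y] [:: x; x]).
Qed.

(** A repeated letter can be moved next to its copy. Otherwise the letters of a circuit can be moved
    to the front of the word. *)
Lemma os_ideal_dependent p s :
  ~~ (uniq s && ([set x in s] \in indep M)) -> (monomial p s <= os_ideal M
    p)%MS.
Proof.
rewrite negb_and => /orP[/not_uniq_perm[x [t /os_ideal_perm->]] | ds].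
  exact: (os_ideal_square p [::]).
have [us|/not_uniq_perm[x [t /os_ideal_perm->]]] := boolP (uniq s); last first.
  exact: (os_ideal_square p [::]).
have [C circC sCs] := dependent_circuit ds.
pose c := [seq x <- s | x \in C]; pose v := [seq x <- s | x \notin C].
have pcv : perm_eq s (c ++ v) by rewrite perm_sym perm_filterC.
rewrite (os_ideal_perm p pcv).
have circc : circuit_word M c.
  rewrite /circuit_word filter_uniq // (_ : [set x in c] = C) //.
  apply/setP=> x; rewrite inE mem_filter andb_idr // => xC.
  by have := subsetP sCs x xC; rewrite inE.
move: circc; case: c {pcv} => [|x c] circc.
  case/andP: circc => _ /minsetP[/= /negP[]].
  by rewrite (_ : [set x in [::]] = set0) ?indep0 //; apply/setP=> x;
    rewrite !inE.
(* Multiplying the circuit relation on the left by its first letter gives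
   [x d (x c) = x c - x x d c], whose last part is made of squares. *)
have := os_ideal_circuit p [:: x] v circc.
rewrite boundary_rel_cons => brel.
rewrite -[X in (X <= _)%MS](subrK (boundary_rel p ([:: x] ++ [:: x]) v c))
  addmx_sub //.
by rewrite summx_sub // => k _; rewrite scalemx_sub // (os_ideal_square p [::]).
Qed.

(** Only the boundary of a one-letter circuit word could reach degree 0, and such a circuit is a
    loop. *)
Lemma os_ideal0 : loopless M -> os_ideal M 0 = 0.
Proof.
move=> /forallP lM; apply/eqP; rewrite -submx0 -[os_ideal M 0]mulmx1.
apply: os_ideal_mul_sub => [u v i | u v i j | u v c]; rewrite mulmx1.
- by rewrite monomial_size_neq ?sub0mx // !size_cat /= addnS.
- by rewrite !monomial_size_neq ?addr0 ?sub0mx // !size_cat /= addnS.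
case: c => [|x [|y c]]; rewrite /circuit_word => /andP[_ Cc].
- by rewrite boundary_rel_nil sub0mx.
- case/minsetP: Cc => /= /negP[].
  rewrite (_ : [set z in [:: x]] = [set x]) ?lM //.
  by apply/setP=> z; rewrite !inE.
rewrite /boundary_rel summx_sub // => k _;
  rewrite monomial_size_neq ?scaler0 ?sub0mx //.
rewrite !size_cat size_take size_drop ltn_ord /=; have := ltn_ord k; rewrite /=.
by move=> ltk; rewrite -lt0n; lia.
Qed.

Lemma sum_by_rank (V : nmodType) (S : {set {set I}}) (P : pred {set I})
    (f : nat -> {set I} -> V) :
  \sum_(p < (rk M).+1) \sum_(F in S | P F && (mrank M F == p)) f p F =
  \sum_(F in S | P F) f (mrank M F) F.
Proof.
rewrite (exchange_big_dep (fun F => (F \in S) && P F)) /=; last first.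
  by move=> p F _ /and3P[-> ->].
apply: eq_bigr => F /andP[FS PF].
have ltF : (mrank M F < (rk M).+1)%N by rewrite ltnS mrankS ?subsetT.
rewrite (big_pred1 (Ordinal ltF)) // => p /=.
by rewrite FS PF /= eq_sym.
Qed.

End Ideal.

(** * Traces on Orlik-Solomon algebras *)

(* A projection with kernel U; its image is a complement of U. *)
HB.lock Definition quo_proj (K : fieldType) n (U : 'M[K]_n) : 'M[K]_n :=
  val_factmod (in_factmod U 1%:M).

Section QuotientTrace.

Variable K : fieldType.

Lemma sub_quo_proj0 m n (U : 'M_n) (X : 'M[K]_(m, n)) :
  (X <= U)%MS -> X *m quo_proj U = 0.
Proof.
rewrite -in_factmod_eq0 quo_proj.unlock val_factmodE mulmxA -in_factmodE =>
  /eqP->.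
by rewrite mul0mx.
Qed.

Lemma quo_proj_complement n (U : 'M[K]_n) : (1%:M - quo_proj U <= U)%MS.
Proof.
rewrite quo_proj.unlock -{1}(add_sub_fact_mod U 1%:M) addrK.
exact: val_submodP.
Qed.

Lemma quo_proj_stable m n (U : 'M_m) (V : 'M_n) (X : 'M[K]_(m, n)) :
  (U *m X <= V)%MS -> quo_proj U *m X *m quo_proj V = X *m quo_proj V.
Proof.
move=> sUX; apply/eqP;
  rewrite eq_sym -subr_eq0 -!mulmxBl -{1}(mul1mx X) -mulmxBl.
apply/eqP; apply: sub_quo_proj0; apply: submx_trans sUX.
by rewrite submxMr // quo_proj_complement.
Qed.

(** Cyclicity of the trace for maps induced between the quotients by [U] and [V]; [quo_proj_stable]
    allows the projections to be inserted or removed. *)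
Lemma mxtrace_quo_mulC m n (U : 'M_m) (V : 'M_n) (X : 'M[K]_(m, n)) (Y : 'M_(n,
  m)) :
    (U *m X <= V)%MS -> (V *m Y <= U)%MS ->
  \tr (X *m Y *m quo_proj U) = \tr (Y *m X *m quo_proj V).
Proof.
move=> sX sY; rewrite -mulmxA -(quo_proj_stable sY) !mulmxA mxtrace_mulC
  !mulmxA.
by rewrite (quo_proj_stable sX) mxtrace_mulC !mulmxA.
Qed.

(** Traces on the quotient representation become traces on the whole space of words, so no basis of
    the quotient is needed. *)
Lemma mxtrace_factmod gT (G : {group gT}) n (rG : mx_representation K G n)
    (U : 'M_n) (modU : mxmodule rG U) g :
  \tr (factmod_repr modU g) = \tr (rG g *m quo_proj U).
Proof.
rewrite -[factmod_repr modU g]/(in_factmod U (val_factmod 1%:M *m rG g)).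
by rewrite in_factmodE -mulmxA mxtrace_mulC -mulmxA quo_proj.unlock
  [val_factmod (in_factmod _ _)]val_factmodE.
Qed.

End QuotientTrace.

Section Evaluation.

Variables (gT : finGroupType) (W : {group gT}).
Implicit Types (g : gT) (phi : 'CF(W)).

Definition cfun_eval g phi : algC := phi g.

Lemma cfun_eval_is_zmod_morphism g : zmod_morphism (cfun_eval g).
Proof. by move=> phi psi; rewrite /cfun_eval !cfunE. Qed.
HB.instance Definition _ g :=
  GRing.isZmodMorphism.Build 'CF(W) algC (cfun_eval g)
    (cfun_eval_is_zmod_morphism g).

Lemma cfun_eval_polyM g (P Q : {poly 'CF(W)}) :
  map_poly (cfun_eval g) (P * Q) =
    map_poly (cfun_eval g) P * map_poly (cfun_eval g) Q.
Proof.
apply/polyP=> k; rewrite coef_map !coefM raddf_sum; apply: eq_bigr => j _.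
by rewrite !coef_map /= /cfun_eval cfunE.
Qed.

Lemma cfun_eval_polyZXn g phi n :
  map_poly (cfun_eval g) (phi *: 'X^n) = phi g *: 'X^n.
Proof.
apply/polyP=> k; rewrite coef_map !coefZ !coefXn /= /cfun_eval.
by case: eqP => _; rewrite ?mulr1 ?mulr0 ?cfunE.
Qed.

End Evaluation.

(** * Traces of a group element on the pieces indexed by flats *)

Section OrlikSolomonTrace.

Variables (gT : finGroupType) (W : {group gT}) (I : finType).
Variables (M : eqmatroid W I) (g : gT).
Hypothesis Wg : g \in W.
Implicit Types (A B F G : {set I}) (p : nat).

Local Notation act A := [set eact M x g | x in A].
Local Notation U := (os_ideal M).
Local Notation Pi p := (quo_proj (os_ideal M p)).
Local Notation gmx p := (word_mx M p g).

Lemma act_set_inj : injective (fun A => act A).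
Proof. exact/imset_inj/act_inj. Qed.

Lemma act_subset A B : (act A \subset act B) = (A \subset B).
Proof.
apply/idP/idP=> [sAB|]; last exact: imsetS.
apply/subsetP=> x xA; rewrite -(mem_imset _ _ (@act_inj _ _ _ (eact M) g)).
by apply: (subsetP sAB); apply: imset_f.
Qed.

Lemma mcl_act A : mcl M (act A) = act (mcl M A).
Proof.
apply/setP=> y; rewrite -[y](actKVin (eact M) Wg); set z := eact M y _.
rewrite (mem_imset _ _ (@act_inj _ _ _ (eact M) g)) !mem_mcl.
have <- : act (z |: A) = eact M z g |: act A by rewrite imsetU1.
by rewrite !eact_mrank.
Qed.

Lemma act_flat F : flat M (act F) = flat M F.
Proof.
have flE G : flat M G = (mcl M G == G).
  by apply/idP/eqP => [/flat_mcl | <-] //; apply: mcl_flat.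
by rewrite !flE mcl_act (inj_eq act_set_inj).
Qed.

Definition fixflats : {set {set I}} := [set F in flats M | act F == F].

Lemma fixflatsP F : reflect (flat M F /\ act F = F) (F \in fixflats).
Proof. by rewrite !inE; apply: (iffP andP) => [[-> /eqP]|[-> ->]]. Qed.

Lemma os_ideal_word_mx p : (U p *m gmx p <= U p)%MS.
Proof. exact: (mxmoduleP (os_ideal_module M p)). Qed.

Lemma word_boundary_mx p : gmx p.+1 *m boundary_mx I p = boundary_mx I p *m gmx
  p.
Proof.
apply: monomial_mx_inj => s ss; rewrite !mulmxA monomial_word_mx.
by rewrite !monomial_boundary_mx boundary_rel_mx.
Qed.

Lemma select_word_mx (P Q : pred {set I}) p : (forall A, Q (act A) = P A) ->
  select_mx P p *m gmx p = gmx p *m select_mx Q p.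
Proof.
move=> PQ; apply: monomial_mx_inj => s ss; rewrite !mulmxA monomial_word_mx.
rewrite !monomial_select_mx (_ : [set x in map _ s] = act [set x in s]) ?PQ.
  by case: ifP; rewrite ?monomial_word_mx ?mul0mx.
apply/setP=> y; rewrite inE; apply/mapP/imsetP=> [[x xs ->]|[x xs ->]].
  by exists x; rewrite ?inE.
by exists x => //; rewrite inE in xs.
Qed.

Definition select_cl F p := select_mx (fun A => mcl M A == F) p.
Definition select_sub G p := select_mx (fun A : {set I} => A \subset G) p.

Lemma os_ideal_select_cl F p : (U p *m select_cl F p <= U p)%MS.
Proof. by apply: os_ideal_select => A B sAB sBA;
  rewrite (mcl_between sAB sBA). Qed.

Lemma os_ideal_select_sub G p : flat M G -> (U p *m select_sub G p <= U p)%MS.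
Proof.
move=> fG; apply: os_ideal_select => A B sAB sBA.
by rewrite -(mcl_sub_flat A fG) -(mcl_sub_flat B fG) (mcl_between sAB sBA).
Qed.

Lemma stable_mulmx n1 n2 n3 (V1 : 'M[algC]_n1) (V2 : 'M_n2) (V3 : 'M_n3)
    (X : 'M_(n1, n2)) (Y : 'M_(n2, n3)) :
  (V1 *m X <= V2)%MS -> (V2 *m Y <= V3)%MS -> (V1 *m (X *m Y) <= V3)%MS.
Proof. by move=> sX sY; rewrite mulmxA (submx_trans (submxMr _ sX)). Qed.

(** In the order of row vectors: project onto the words of closure [F], act by [g], then pass to the
    quotient. *)
Definition os_trace_cl F p := \tr (select_cl F p *m gmx p *m Pi p).
Definition os_trace_sub G p := \tr (select_sub G p *m gmx p *m Pi p).

(** The piece of [F] is sent to that of another flat, so this diagonal block is 0. In terms of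
    traces, the projection is squared and one copy is moved cyclically past [g]. *)
Lemma os_trace_cl_moved F p : act F != F -> os_trace_cl F p = 0.
Proof.
move=> neF; have selg : select_cl F p *m gmx p = gmx p *m select_cl (act F) p.
  by apply: select_word_mx => A; rewrite mcl_act (inj_eq act_set_inj).
have selsel : select_cl F p = select_cl F p *m select_cl F p.
  by rewrite mul_select_mx; apply: eq_select_mx => A /=; rewrite andbb.
rewrite /os_trace_cl selsel -[_ *m gmx p]mulmxA selg (@mxtrace_quo_mulC _ _ _
  (U p) (U p)).
- rewrite -[_ *m select_cl F p]mulmxA mul_select_mx select_mx_pred0 => [|A /=].
    by rewrite mulmx0 mul0mx mxtrace0.
  by apply: contraNF neF => /andP[/eqP<-].
- exact: os_ideal_select_cl.
exact: stable_mulmx (os_ideal_word_mx p) (os_ideal_select_cl _ p).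
Qed.

(** An independent word of length [p] has a closure of rank [p]; all the words selected here are
    therefore in the ideal. *)
Lemma os_trace_cl_rank F p : mrank M F != p -> os_trace_cl F p = 0.
Proof.
move=> neF; rewrite /os_trace_cl sub_quo_proj0 ?mxtrace0 //.
apply: submx_trans (os_ideal_word_mx p); apply: submxMr.
apply: monomial_submx => s ss; rewrite monomial_select_mx.
case: eqP => [clF|_]; last exact: sub0mx.
apply: os_ideal_dependent; apply: contra neF => /andP[us].
rewrite -clF mrank_mcl indep_mrank cardsE => /eqP->.
by rewrite -ss; apply/eqP/card_uniqP.
Qed.

Lemma select_sub_sum G p : flat M G ->
  select_sub G p = \sum_(F in flats M | F \subset G) select_cl F p.
Proof.
move=> fG; apply: monomial_mx_inj => s ss;
  rewrite mulmx_sumr monomial_select_mx.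
under eq_bigr do rewrite monomial_select_mx.
rewrite -big_mkcondr /= -(mcl_sub_flat _ fG); case: ifP => sG.
  rewrite (big_pred1 (mcl M [set x in s])) // => F /=.
  rewrite eq_sym; case: eqP => [->|]; rewrite ?andbF //.
  by rewrite inE mcl_flat sG.
rewrite big_pred0 // => F; apply: contraFF sG => /andP[/andP[_ sFG]] /eqP->.
by [].
Qed.

Lemma os_trace_sub_sum G p : flat M G ->
  os_trace_sub G p = \sum_(F in fixflats | (F \subset G) && (mrank M F == p))
    os_trace_cl F p.
Proof.
move=> fG; rewrite /os_trace_sub select_sub_sum // !mulmx_suml raddf_sum /=.
rewrite (bigID (fun F => (act F == F) && (mrank M F == p))) /= [X in _ + X]big1
  ?addr0.
  by apply: eq_bigl => F; rewrite !inE; do !case: (_ == _);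
    rewrite ?andbF ?andbT.
move=> F /andP[_]; rewrite negb_and -/(os_trace_cl F p).
by case/orP=> [/os_trace_cl_moved->|/os_trace_cl_rank->].
Qed.

Lemma os_trace_repr p :
  \tr (os_repr M p g) = \sum_(F in fixflats | mrank M F == p) os_trace_cl F p.
Proof.
rewrite mxtrace_factmod.
transitivity (os_trace_sub setT p).
  congr (\tr (_ *m _)); rewrite -[LHS]mul1mx; congr (_ *m _).
  by apply: monomial_mx_inj => s ss; rewrite mulmx1 monomial_select_mx subsetT.
rewrite os_trace_sub_sum ?flatT //; apply: eq_bigl => F.
by rewrite subsetT.
Qed.

Lemma quo_proj_big : Pi (rk M).+1 = 0.
Proof.
rewrite -[LHS]mul1mx sub_quo_proj0 //; apply: monomial_submx => s ss.
rewrite mulmx1; apply: os_ideal_dependent; apply/negP=> /andP[us is_].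
have := card_indep_mrank is_ (subsetT _); rewrite cardsE (card_uniqP us) ss.
by rewrite ltnn.
Qed.

(** The homotopy identity writes the trace in degree [p.+1] as [c p.+1 + c p]. The alternating sum
    reduces to its last [c], a trace in degree [(rk M).+1], where the algebra vanishes. *)
Lemma os_trace_telescope G i : G \in fixflats -> i \in G ->
  \sum_(p < (rk M).+1) (-1) ^+ p * os_trace_sub G p = 0.
Proof.
case/fixflatsP=> fG gG iG; pose Q := select_sub G.
pose D p := Q p.+1 *m boundary_mx I p; pose E p := Q p *m letter_mx i p.
have gQ p : Q p *m gmx p = gmx p *m Q p.
  by apply: select_word_mx => A; rewrite -{1}gG; rewrite act_subset.
have gD p : gmx p.+1 *m D p = D p *m gmx p.
  by rewrite /D mulmxA -gQ -mulmxA word_boundary_mx mulmxA.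
have UQ p := os_ideal_select_sub p fG.
have UD p : (U p.+1 *m D p <= U p)%MS := stable_mulmx (UQ _) (os_ideal_boundary
  M p).
have UE p : (U p *m E p <= U p.+1)%MS := stable_mulmx (UQ _) (os_ideal_letter M
  i p).
pose c p := \tr (gmx p.+1 *m (D p *m E p) *m Pi p.+1).
(* [g] commutes with [D], but it may move the letter [i] and need not commute with [E]. Moving [D]
   cyclically is enough. *)
have EDc p : \tr (gmx p *m (E p *m D p) *m Pi p) = c p.
  rewrite mulmxA (@mxtrace_quo_mulC _ _ _ (U p) (U p.+1)) ?UD //.
    by rewrite /c [gmx _ *m (_ *m E p)]mulmxA gD -[D p *m _ *m E p]mulmxA.
  exact: stable_mulmx (os_ideal_word_mx p) (UE p).
have ED p : E p *m D p = Q p *m (letter_mx i p *m boundary_mx I p).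
  by rewrite /E /D !mulmxA -select_letter_mx.
have DE p : D p *m E p = Q p.+1 *m (boundary_mx I p *m letter_mx i p).
  by rewrite /E /D !mulmxA -select_boundary_mx.
have t0 : os_trace_sub G 0 = c 0%N.
  by rewrite -EDc ED letter_boundary_mx0 mulmx1 -gQ.
have tS p : os_trace_sub G p.+1 = c p.+1 + c p.
  rewrite -EDc /c -mxtraceD -mulmxDl -mulmxDr ED DE -mulmxDr letter_boundary_mx.
  by rewrite mulmx1 -gQ.
(* [E] is a contracting homotopy for [D], so the alternating sum telescopes. *)
have sum_t n : \sum_(p < n.+1) (-1) ^+ p * os_trace_sub G p = (-1) ^+ n * c n.
  elim: n => [|n IHn]; first by rewrite big_ord1 t0.
  by rewrite big_ord_recr /= IHn tS exprS; ring.
by rewrite sum_t /c quo_proj_big mulmx0 mxtrace0 mulr0.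
Qed.

Definition os_mobius F := (-1) ^+ mrank M F * os_trace_cl F (mrank M F).

Lemma os_trace_empty : loopless M -> os_trace_cl set0 0 = 1.
Proof.
move=> lM; have word0 (X : 'M_(nwords I 0)) :
    monomial 0 [::] *m X = monomial 0 [::] -> X = 1%:M.
  by move=> X1; apply: monomial_mx_inj => s /size0nil->; rewrite X1 mulmx1.
rewrite /os_trace_cl; have -> : select_cl set0 0 = 1%:M.
  apply: word0; rewrite monomial_select_mx (_ : [set x in [::]] = set0).
    by rewrite flat_mcl ?loopless_flat0 ?eqxx.
  by apply/setP=> x; rewrite !inE.
have -> : gmx 0 = 1%:M by apply: word0; rewrite monomial_word_mx.
have -> : Pi 0 = 1%:M.
  apply/eqP; rewrite eq_sym -subr_eq0 -submx0.
  by have := quo_proj_complement (U 0); rewrite {2}os_ideal0.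
by rewrite !mulmx1 mxtrace1 /nwords card_tuple expn0.
Qed.

Lemma sum_os_mobius G : loopless M -> G \in fixflats ->
  \sum_(F in fixflats | (set0 \subset F) && (F \subset G)) os_mobius F = (set0
    == G)%:R.
Proof.
move=> lM GS; have [<-|neG] := eqVneq.
  rewrite (big_pred1 set0) => [|F]; last first.
    rewrite /= sub0set subset0; case: eqP => [->|]; rewrite ?andbF ?andbT //.
    by apply/fixflatsP; rewrite loopless_flat0 ?imset0.
  by rewrite /os_mobius mrank0 os_trace_empty // mulr1.
have /set0Pn[i iG] : G != set0 by rewrite eq_sym.
rewrite mulr0n -[RHS](os_trace_telescope GS iG); have [fG _] := fixflatsP _ GS.
under [RHS]eq_bigr do rewrite os_trace_sub_sum // mulr_sumr.
rewrite (sum_by_rank M fixflats (fun F : {set I} => F \subset G) (fun p F =>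
  (-1) ^+ p * os_trace_cl F p)).
by apply: eq_bigl => F; rewrite sub0set.
Qed.

Lemma os_mobiusE F : loopless M -> F \in fixflats ->
  os_mobius F = mobius algC fixflats set0 F.
Proof.
move=> lM FS; apply: (mobius_unique (S := fixflats)) => //; last exact: sub0set.
by move=> G GS _; apply: sum_os_mobius.
Qed.

Lemma eqchar_kernel : loopless M ->
  map_poly (cfun_eval g) (eqchar M) = kernel algC fixflats (mrank M) set0 setT.
Proof.
move=> lM; rewrite raddf_sum /= /kernel.
transitivity (\sum_(p < (rk M).+1) \sum_(F in fixflats | true && (mrank M F ==
  p))
    ((-1) ^+ p * os_trace_cl F p) *: 'X^(rk M - p) : {poly algC}).
  apply: eq_bigr => p _; rewrite cfun_eval_polyZXn -scaler_suml -mulr_sumr.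
  (* The power of -1 is a class function on one side and a number on the other; both are reduced to
     the parity of [p]. *)
  congr (_ *: _); rewrite /cfun_eval -[in LHS]signr_odd -[in RHS]signr_odd.
  have os_p : os_char M p g = \sum_(F in fixflats | mrank M F == p) os_trace_cl
    F p.
    by rewrite cfunE Wg mulr1n os_trace_repr.
  rewrite -os_p; case: odd; rewrite ?expr1 ?expr0 ?mulN1r ?mul1r //.
  by rewrite [LHS]cfunE.
rewrite (sum_by_rank M fixflats predT (fun p F => ((-1) ^+ p * os_trace_cl F p)
  *: 'X^(rk M - p))).
apply: eq_big => F; first by rewrite sub0set subsetT.
by case/andP=> FS _; rewrite -os_mobiusE.
Qed.

End OrlikSolomonTrace.

(** * Posets of fixed flats *)

Section FixedFlats.

Variables (gT : finGroupType) (W : {group gT}) (I : finType).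
Variable M : eqmatroid W I.
Implicit Types (F G : {set I}) (g w : gT).

Lemma fixflats_mono g :
  {in fixflats M g &, forall F G : {set I}, F \proper G -> (mrank M F < mrank M
    G)%N}.
Proof. by move=> F G /fixflatsP[fF _] _; apply: flat_mrank_ltn. Qed.

Lemma fixflatsT g : g \in W -> [set: I] \in fixflats M g.
Proof.
move=> Wg; apply/fixflatsP; split; first exact: flatT.
apply/setP=> x; rewrite !inE; apply/imsetP; exists (eact M x g^-1%g) => //.
by rewrite actKVin.
Qed.

Lemma fixflats0 g : loopless M -> set0 \in fixflats M g.
Proof. by move=> lM; apply/fixflatsP; rewrite loopless_flat0 ?imset0. Qed.

Lemma mem_stab F g :
  (g \in stab M F) = (g \in W) && ([set eact M x g | x in F] == F).
Proof.
apply/setIP/andP=> [[Wg /astabs_setact gF]|[Wg /eqP gF]].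
  by split=> //; apply/eqP.
split=> //; rewrite !inE Wg; apply/subsetP=> x xF; rewrite inE.
by have := imset_f (fun x => eact M x g) xF; rewrite gF.
Qed.

Lemma stab_fixflats F g : g \in W -> flat M F -> (g \in stab M F) = (F \in
  fixflats M g).
Proof. by move=> Wg fF; rewrite mem_stab Wg !inE fF. Qed.

(** For a right action, acting by [g] and then [w] is acting by [w] and then [g ^ w]. *)
Lemma fixflats_conj g w F : g \in W -> w \in W ->
  ([set eact M x w | x in F] \in fixflats M (g ^ w)) = (F \in fixflats M g).
Proof.
move=> Wg Ww; rewrite !inE act_flat //; congr (_ && _).
rewrite -(inj_eq (@act_set_inj _ _ _ M w) [set eact M x g | x in F]);
  congr (_ == _).
rewrite -!imset_comp; apply: eq_imset => x /=.
by rewrite -!actMin ?groupM ?groupV // ?groupJ // -conjgC.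
Qed.

Section Conjugation.

Variables g w : gT.
Hypotheses (Wg : g \in W) (Ww : w \in W).

Let psi F := [set eact M x w | x in F].

Lemma conj_convex : {in fixflats M g & fixflats M g, forall A B : {set I},
  {in fixflats M (g ^ w), forall E : {set I},
  psi A \subset E -> E \subset psi B -> exists2 C, C \in fixflats M g & E = psi
    C}}.
Proof.
move=> A B _ _ E ES _ _.
have eE : E = psi [set eact M x w^-1%g | x in E].
  rewrite /psi -imset_comp -[LHS]imset_id; apply: eq_imset => x /=.
  by rewrite actKVin.
by exists [set eact M x w^-1%g | x in E];
  rewrite // -(fixflats_conj _ Wg Ww) -/(psi _) -eE.
Qed.

Lemma kls_conj F : F \in fixflats M g ->
  kls algC (fixflats M (g ^ w)) (mrank M) (psi F) =
  kls algC (fixflats M g) (mrank M) F.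
Proof.
apply: kls_transfer; rewrite ?fixflatsT //.
- by move=> A AS; rewrite fixflats_conj.
- by move=> A B _ _; apply: act_subset.
- exact: conj_convex.
- by move=> A B _ _ _; rewrite !eact_mrank.
by have /fixflatsP[] := fixflatsT Ww.
Qed.

Lemma kernel_conj F G : F \in fixflats M g -> G \in fixflats M g -> F \subset G
  ->
  kernel algC (fixflats M (g ^ w)) (mrank M) (psi F) (psi G) =
  kernel algC (fixflats M g) (mrank M) F G.
Proof.
apply: kernel_transfer.
- by move=> A AS; rewrite fixflats_conj.
- by move=> A B _ _; apply: act_subset.
- exact: conj_convex.
by move=> A B _ _ _; rewrite !eact_mrank.
Qed.

End Conjugation.

End FixedFlats.

(** * Localizations and contractions as intervals of fixed flats *)

Section LocalizationContraction.

Variables (gT : finGroupType) (W : {group gT}) (I : finType).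
Variable M : eqmatroid W I.
Variables (F : {set I}) (g : gT).
Hypotheses (fF : flat M F) (Sg : g \in stab M F).

Let loc (A : {set locI F}) : {set I} := val @: A.
Let contr (A : {set contrI F}) : {set I} := val @: A :|: F.

Let Wg : g \in W.
Proof. by case/setIP: Sg. Qed.

Let gF : [set eact M x g | x in F] = F.
Proof. by move: Sg; rewrite mem_stab => /andP[_ /eqP]. Qed.

Lemma fixflats_loc A : (A \in fixflats (eqloc M F) g) = (loc A \in fixflats M
  g).
Proof.
rewrite !inE /= flat_loc // -loc_actE //; congr (_ && _).
by rewrite (inj_eq (imset_inj val_inj)).
Qed.

Lemma contr_subset A B : (contr A \subset contr B) = (A \subset B).
Proof.
apply/idP/idP=> [sAB|sAB]; last by rewrite setSU // imsetS.
apply/subsetP=> x xA; have: val x \in contr B.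
  by apply: (subsetP sAB); rewrite inE imset_f.
by rewrite inE (negbTE (valP x)) orbF (mem_imset _ _ val_inj).
Qed.

Lemma contr_inj : injective contr.
Proof.
by move=> A B eAB; apply/eqP; rewrite eqEsubset -!contr_subset eAB subxx.
Qed.

Lemma fixflats_contr A : (A \in fixflats (eqcontr M F) g) = (contr A \in
  fixflats M g).
Proof.
rewrite !inE /= flat_contr //; congr (_ && _).
rewrite -(inj_eq contr_inj) /contr contr_actE //.
by rewrite imsetU gF.
Qed.

Lemma kernel_loc : loopless M ->
  kernel algC (fixflats (eqloc M F) g) (mrank (eqloc M F)) set0 setT =
  kernel algC (fixflats M g) (mrank M) set0 F.
Proof.
move=> lM; have e0 : loc set0 = set0 by rewrite /loc imset0.
have eT : loc setT = F.
  apply/setP=> x; apply/imsetP/idP=> [[y _ ->]|xF]; first exact: valP.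
  by exists (Sub x xF).
rewrite -[in RHS]eT -[in RHS]e0; symmetry; apply: kernel_transfer.
- by move=> A; rewrite fixflats_loc.
- move=> A B _ _; apply/idP/idP=> [sAB|]; last exact: imsetS.
  apply/subsetP=> x xA; rewrite -(mem_imset _ _ val_inj).
  by apply: (subsetP sAB); apply: imset_f.
- move=> A B _ _ E ES _ sEB; have eE : E = loc (val @^-1: E).
    apply/setP=> x; apply/idP/imsetP=> [xE|[y]]; last by rewrite inE => yE ->.
    by have /imsetP[y _ xy] := subsetP sEB x xE; exists y; rewrite // inE -xy.
  by exists (val @^-1: E); rewrite // fixflats_loc -eE.
- by move=> A B _ _ _; rewrite !mrank_loc.
- by rewrite fixflats_loc e0 fixflats0.
- by rewrite fixflats_loc eT; apply/fixflatsP.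
exact: sub0set.
Qed.

Lemma kls_contr :
  kls algC (fixflats (eqcontr M F) g) (mrank (eqcontr M F)) set0 =
  kls algC (fixflats M g) (mrank M) F.
Proof.
have eF : contr set0 = F by rewrite /contr imset0 set0U.
rewrite -[in RHS]eF; symmetry; apply: kls_transfer.
- by move=> A; rewrite fixflats_contr.
- by move=> A B _ _; apply: contr_subset.
- move=> A B _ _ E ES sAE _.
  have sFE : F \subset E by apply: subset_trans sAE; apply: subsetUr.
  have eE : E = contr (val @^-1: E).
    apply/setP=> x; rewrite inE; have [xF|xF] := boolP (x \in F).
      by rewrite orbT (subsetP sFE).
    rewrite orbF; apply/idP/imsetP=> [xE|[y]]; last by rewrite inE => yE ->.
    by exists (Sub x xF); rewrite ?inE.
  by exists (val @^-1: E); rewrite // fixflats_contr -eE.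
(* Ranks in the contraction are shifted by [mrank M F], which cancels in differences. *)
- by move=> A B _ _ _; rewrite /contr -!mrank_contr subnDr.
- exact: fixflatsT.
- exact: imset_val_contrT.
by rewrite fixflats_contr eF; apply/fixflatsP.
Qed.

End LocalizationContraction.

(** * Equivariant Kazhdan-Lusztig polynomials *)

Section InductionSum.

Variables (gT : finGroupType) (W : {group gT}) (I : finType).
Variable M : eqmatroid W I.
Implicit Types (F : {set I}) (g h w : gT).

Local Notation act w F := [set eact M x w | x in F].
Local Notation reps := (orbit_transversal (eact M)^* W (flats M)).

Lemma acts_flats : [acts W, on flats M | (eact M)^*].
Proof.
apply/subsetP=> w Ww; rewrite !inE Ww; apply/subsetP=> F; rewrite !inE => fF.
by rewrite /= act_flat.
Qed.

Lemma sum_orbit (V : nmodType) (u : {set I} -> V) :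
  \sum_(F in reps) \sum_(G in orbit (eact M)^* W F) u G = \sum_(G in flats M) u
    G.
Proof.
have [_ sXL Xorb Xrep] := orbit_transversalP acts_flats.
rewrite (exchange_big_dep (mem (flats M))) /=; last first.
  move=> F G /(subsetP sXL) FL; apply: subsetP.
  by rewrite acts_sub_orbit // acts_flats.
apply: eq_bigr => G GL; have [w Ww GwX] := Xrep G GL.
have oG : G \in orbit (eact M)^* W ((eact M)^* G w)%act.
  by rewrite orbit_in_sym ?mem_orbit //.
rewrite (big_pred1 ((eact M)^* G w)%act) // => F /=.
apply/andP/eqP=> [[FX GF]|->] //.
apply/eqP; rewrite -(Xorb F) //; apply: orbit_in_trans GF;
  rewrite ?mem_orbit //.
Qed.

(** The elements of [W] sending [F] to a given member of its orbit form a coset of the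
    stabilizer. *)
Lemma sum_act_orbit F (u : {set I} -> algC) :
  \sum_(w in W) u (act w F) = #|stab M F|%:R * \sum_(G in orbit (eact M)^* W F)
    u G.
Proof.
rewrite (partition_big (fun w => act w F) (mem (orbit (eact M)^* W F))) /=;
  last first.
  by move=> w Ww; apply: mem_orbit.
rewrite mulr_sumr; apply: eq_bigr => G /orbitP[a Wa aG].
rewrite (eq_bigr (fun=> u G)) => [|w /andP[_ /eqP->]] //.
rewrite sumr_const [RHS]mulr_natl; congr (_ *+ _).
transitivity #|amove (eact M)^* W F G|; first by apply: eq_card => w;
  rewrite !inE.
by rewrite -aG amove_act // card_rcoset astab1_set.
Qed.

(** The family [v], compatible with conjugation, glues the characters [psi F] of the various
    stabilizers. The factor [#|stab M F|] from counting cosets cancels the denominator of the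
    induced character. *)
Lemma sum_cfInd_orbits (psi : forall F, 'CF(stab M F)) (v : {set I} -> gT ->
  algC) g :
    g \in W ->
    {in flats M, forall F, {in stab M F, psi F =1 v F}} ->
    {in flats M, forall F h w, h \in stab M F -> w \in W -> v (act w F) (h ^
      w)%g = v F h} ->
  \sum_(F in reps) 'Ind[W] (psi F) g = \sum_(F in fixflats M g) v F g.
Proof.
move=> Wg psi_v v_conj; have [_ sXL _ _] := orbit_transversalP acts_flats.
pose u F := if F \in fixflats M g then v F g else 0.
transitivity (\sum_(F in reps) \sum_(G in orbit (eact M)^* W F) u G);
  last first.
  rewrite sum_orbit /u -big_mkcondr; apply: eq_bigl => F.
  by apply: andb_idl; case/setIdP.
apply: eq_bigr => F /(subsetP sXL) FL; have fF : flat M F by rewrite inE in FL.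
rewrite cfIndE ?subsetIl //; apply: (canLR (mulKf _)); first by rewrite neq0CG.
(* With [w] replaced by its inverse, the terms are [psi F (g ^ w^-1)], which [v_conj] turns into the
   values of [v] at [act w F] and [g]. *)
rewrite -sum_act_orbit (reindex_inj invg_inj) /=.
apply: eq_big => [w|w Ww']; first by rewrite groupV.
have Ww : w \in W by rewrite -groupV.
have WgwV : (g ^ w^-1)%g \in W by rewrite groupJ.
rewrite /u -{2 3}(conjgKV w g).
rewrite fixflats_conj // -stab_fixflats //; case: ifP => [Sg|nSg].
  by rewrite v_conj // psi_v.
by rewrite cfun0 ?nSg.
Qed.

End InductionSum.

HB.instance Definition _ (gT : finGroupType) (W : {group gT}) := [isSub for
  @grpoly gT W].

Section KazhdanLusztigPolynomial.

Variables (gT : finGroupType) (W : {group gT}) (I : finType).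
Variable M : eqmatroid W I.
Implicit Types (F : {set I}) (g h w : gT).

Definition kls_at g : {poly algC} := kls algC (fixflats M g) (mrank M) set0.

(* The fallback value 0 is only met for matroids with loops. *)
Definition kl_coef k : 'CF(W) :=
  insubd (0 : 'CF(W)) [ffun g => if g \in W then (kls_at g)`_k else 0].

Definition kl_poly : {poly 'CF(W)} := \poly_(k < ((rk M).-1)./2.+1) kl_coef k.

Hypothesis lM : loopless M.

Lemma kl_coefE g k : g \in W -> kl_coef k g = (kls_at g)`_k.
Proof.
move=> Wg; rewrite -[kl_coef k g]/(val (kl_coef k) g) insubdK ?ffunE ?Wg //.
(* Translation by [y] fixes [set0], so [kls_conj] gives invariance under conjugation. *)
rewrite unfold_in genGid; apply: intro_class_fun => [x y Wx Wy|x /negbTE-> //].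
rewrite (groupJr _ Wy) Wx; have := kls_conj Wx Wy (fixflats0 x lM).
by rewrite imset0 /kls_at => ->.
Qed.

Lemma kl_polyE g : g \in W -> map_poly (cfun_eval g) kl_poly = kls_at g.
Proof.
move=> Wg; apply/polyP=> k; rewrite coef_map coef_poly /=.
case: ltnP => [_|le_k]; first exact: kl_coefE.
rewrite raddf0 nth_default //; apply: leq_trans le_k.
by apply: leq_trans (size_kls _ _ _ _) _; rewrite mrank0 subn0.
Qed.

(** A loopless matroid of rank 0 has an empty ground set, so [set0] is the top of the poset. *)
Lemma kl_poly_rk0 : rk M = 0%N -> kl_poly = 1.
Proof.
move=> r0; have T0 : [set: I] = set0.
  apply/setP=> x; rewrite !inE; apply/negbTE/negP=> _.
  have: (mrank M [set x] <= rk M)%N by rewrite mrankS ?subsetT.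
  have := forallP lM x; rewrite indep_mrank => /eqP->.
  by rewrite cards1 r0.
apply/polyP=> k; apply/cfun_inP=> g Wg.
rewrite -[LHS]/(cfun_eval g _) -coef_map kl_polyE // /kls_at -T0 klsT !coef1.
by case: (k == 0)%N; rewrite ?mulr1n ?mulr0n ?cfun1E ?Wg ?cfunE.
Qed.

Lemma eqchar_kl_polyE F g : F \in flats M -> g \in stab M F ->
  map_poly (cfun_eval g) (eqchar (eqloc M F)) =
    kernel algC (fixflats M g) (mrank M) set0 F.
Proof.
rewrite inE => fF Sg.
by rewrite eqchar_kernel ?kernel_loc //; apply: loopless_loc.
Qed.

End KazhdanLusztigPolynomial.

Lemma kl_polyE_contr gT (W : {group gT}) I (M : eqmatroid W I) F g :
    F \in flats M -> g \in stab M F ->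
  map_poly (cfun_eval g) (kl_poly (eqcontr M F)) =
    kls algC (fixflats M g) (mrank M) F.
Proof.
rewrite inE => fF Sg.
by rewrite kl_polyE ?[kls_at _ _]kls_contr //; apply: loopless_contr.
Qed.

(** * The recursion over orbits of flats and the integrality of the coefficients *)

Section Recursion.

Variables (gT : finGroupType) (W : {group gT}) (I : finType).
Variable M : eqmatroid W I.
Hypothesis lM : loopless M.

Local Notation reps := (orbit_transversal (eact M)^* W (flats M)).

Let kl_term F := eqchar (eqloc M F) * kl_poly (eqcontr M F).

Lemma kl_termE F g : F \in flats M -> g \in stab M F ->
  map_poly (cfun_eval g) (kl_term F) =
    kernel algC (fixflats M g) (mrank M) set0 F * kls algC (fixflats M g)
      (mrank M) F.
Proof.
by move=> FL Sg; rewrite cfun_eval_polyM eqchar_kl_polyE ?kl_polyE_contr.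
Qed.

Lemma coef_grInd (H : {group gT}) (P : {poly 'CF(H)}) k :
  (grInd W P)`_k = 'Ind[W] P`_k.
Proof. exact: coef_map. Qed.

(** At each [g] and in each degree, the induced characters add up to a sum over the flats fixed by
    [g], which is [kls_rev] at [set0]. *)
Lemma kl_poly_rec : reverse (rk M) (kl_poly M) = \sum_(F in reps) grInd W
  (kl_term F).
Proof.
apply/polyP=> k; apply/cfun_inP=> g Wg; rewrite coef_sum sum_cfunE.
under eq_bigr do rewrite coef_grInd.
pose v F h := (kernel algC (fixflats M h) (mrank M) set0 F *
               kls algC (fixflats M h) (mrank M) F)`_k.
rewrite (sum_cfInd_orbits (v := v)) //; first last.
- move=> F; rewrite inE => fF h w Sh Ww; have Wh : h \in W by case/setIP: Sh.
  rewrite stab_fixflats // in Sh.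
  by rewrite /v kls_conj // -[in LHS](imset0 (fun x => eact M x w)) kernel_conj
    // ?fixflats0 ?sub0set.
- by move=> F FL h Sh; rewrite -[LHS]/(cfun_eval h _) -coef_map kl_termE.
have := kls_rev algC (@fixflats_mono _ _ _ M g) (fixflatsT M Wg) (fixflats0 g
  lM).
move/polyP/(_ k); rewrite coef_sum mrank0 subn0 coef_revp.
under eq_bigl do rewrite sub0set andbT.
move=> <-; rewrite coef_poly ltnS -/(rk M); case: leqP => _;
  last by rewrite cfunE.
by rewrite -[LHS]/(cfun_eval g _) -coef_map kl_polyE.
Qed.

Lemma set0_reps : set0 \in reps.
Proof.
have [_ _ _ Xrep] := orbit_transversalP (acts_flats M).
have [|w _] := Xrep set0; first by rewrite inE loopless_flat0.
by rewrite /= /setact imset0.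
Qed.

Lemma reps_flat F : F \in reps -> flat M F.
Proof.
have [_ /subsetP sXL _ _] := orbit_transversalP (acts_flats M).
by move/sXL; rewrite inE.
Qed.

Lemma stab0 : stab M set0 :=: W.
Proof.
apply/setP=> w; rewrite mem_stab imset0 eqxx andbT.
by [].
Qed.

(** [stab M set0] and [W] have the same elements but index different types of class functions, so
    the comparison is made on values. *)
Lemma cfInd_stab0 (phi : 'CF(stab M set0)) g : g \in W -> 'Ind[W] phi g = phi g.
Proof.
move=> Wg; rewrite cfIndE ?subsetIl // (eq_bigr (fun=> phi g)) => [|w Ww].
  rewrite sumr_const; have <- : #|stab M set0| = #|W| by rewrite stab0.
  by rewrite -[phi g *+ _]mulr_natl mulKf ?neq0CG.
by rewrite cfunJ // stab0.
Qed.

Lemma rk_contr_lt F : F \in reps -> F != set0 -> (rk (eqcontr M F) < rk M)%N.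
Proof.
move=> /reps_flat fF neF;
  rewrite -(rk_contr M F) -addn1 leq_add2l -[0%N](mrank0 M).
by rewrite flat_mrank_ltn ?loopless_flat0 // proper0.
Qed.

Lemma eqchar_vchar gT' (W' : {group gT'}) I' (M' : eqmatroid W' I') :
  eqchar M' \is a polyOver 'Z[irr W'].
Proof.
apply: rpred_sum => p _; apply/polyOverP=> k; rewrite coefZ coefXn.
by rewrite !(rpredM, rpredX, rpredN1, rpred_nat) // char_vchar // cfRepr_char.
Qed.

(** Isolating the term of [set0] expresses each low coefficient as the opposite of a sum of
    characters induced from the contractions by nonempty flats. *)
Lemma kl_poly_vchar_step :
    (forall F, F \in reps -> F != set0 ->
       kl_poly (eqcontr M F) \is a polyOver 'Z[irr (stab M F)]) ->
  (0 < rk M)%N -> kl_poly M \is a polyOver 'Z[irr W].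
Proof.
move=> IH r_gt0; apply/polyOverP=> k.
have [le_k|lt_k] := leqP ((rk M).-1)./2.+1 k;
  first by rewrite coef_poly ltnNge le_k rpred0.
have := congr1 (fun P : {poly 'CF(W)} => P`_k) kl_poly_rec.
(* Here [2 k < rk M], so the left side is the coefficient of [kl_poly M] in degree [rk M - k],
   beyond the degree bound, hence 0. *)
rewrite coef_poly ifT; last by lia.
rewrite [(kl_poly M)`_(_ - _)]coef_poly ifF; last by lia.
rewrite coef_sum (bigD1 set0) ?set0_reps //= => /esym/eqP;
  rewrite addrC addr_eq0.
suff -> : (grInd W (kl_term set0))`_k = (kl_poly M)`_k.
  rewrite -eqr_oppLR => /eqP<-; rewrite rpredN rpred_sum // => F /andP[FX neF].
  rewrite coef_grInd cfInd_vchar // coefM rpred_sum // => j _.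
  by rewrite rpredM //; apply: (polyOverP _); [apply: eqchar_vchar | apply: IH].
apply/cfun_inP=> g Wg; rewrite coef_grInd cfInd_stab0 //.
rewrite -[LHS]/(cfun_eval g _) -[RHS]/(cfun_eval g _) -!coef_map kl_polyE //
  kl_termE.
- by rewrite kernelxx ?fixflats0 // mul1r.
- by rewrite inE loopless_flat0.
by rewrite stab0.
Qed.

End Recursion.

Lemma kl_poly_vchar gT (W : {group gT}) I (M : eqmatroid W I) :
  loopless M -> kl_poly M \is a polyOver 'Z[irr W].
Proof.
have [n] := ubnP (rk M); elim: n => // n IHn in gT W I M *;
  rewrite ltnS => le_rn lM.
have [r0|r_gt0] := posnP (rk M); first by rewrite kl_poly_rk0 ?rpred1.
apply: kl_poly_vchar_step => // F FX neF; apply: IHn.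
  by apply: leq_trans le_rn; apply: rk_contr_lt.
by apply/loopless_contr/(reps_flat FX).
Qed.

(** The default value 0 can only occur for matroids with loops, by [kl_poly_vchar]. *)
Definition kl_rep gT (W : {group gT}) I (M : eqmatroid W I) : grVRep W :=
  insubd (GrVRep (rpred0 _)) (kl_poly M).

Lemma kl_repE gT (W : {group gT}) I (M : eqmatroid W I) :
  loopless M -> kl_rep M = kl_poly M :> {poly 'CF(W)}.
Proof. by move=> lM; rewrite [LHS]insubdK // kl_poly_vchar. Qed.

(** The flats of [M'] fixed by [w] are those of [M] fixed by [phi w], so the values at [w] and at
    [phi w] come from the same poset. *)
Lemma kl_poly_pull (gT gT' : finGroupType) (W : {group gT}) (W' : {group gT'})
    (phi : {morphism W' >-> gT}) (I : finType)
    (M : eqmatroid W I) (M' : eqmatroid W' I) :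
    loopless M -> phi @* W' \subset W -> indep M' = indep M ->
    (forall x w, w \in W' -> eact M' x w = eact M x (phi w)) ->
  kl_poly M' = grpull phi (kl_poly M).
Proof.
move=> lM sW eM eact'.
have er : mrank M' = mrank M by rewrite /mrank eM.
have lM' : loopless M' by rewrite /loopless eM.
apply/polyP=> k; apply/cfun_inP=> w W'w.
have Wphi : phi w \in W by rewrite (subsetP sW) // mem_morphim.
rewrite coef_map_id0; last by rewrite /cfpull !linear0.
rewrite cfMorphE // cfResE ?mem_morphim //.
rewrite -[LHS]/(cfun_eval w _) -[RHS]/(cfun_eval (phi w) _) -!coef_map
  !kl_polyE //.
rewrite /kls_at er; congr (kls _ _ _ _)`_k; apply/setP=> F.
rewrite !inE /flat er; congr (_ && (_ == _)).
by apply: eq_imset => x; apply: eact'.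
Qed.

Lemma kl_rep_eqKL : eqKL (@kl_rep).
Proof.
split=> [gT W I M lM r0 | gT W I M lM r_gt0 | gT W I M lM |
         gT gT' W W' phi I M M' lM sW eM eact'].
- by rewrite kl_repE // kl_poly_rk0.
- rewrite kl_repE //.
  have : (size (kl_poly M) <= ((rk M).-1)./2.+1)%N := size_poly _ _.
  by move: (size _) => s; lia.
- rewrite kl_repE // kl_poly_rec //; apply: eq_bigr => F /reps_flat fF.
  by rewrite kl_repE //; apply: loopless_contr.
have lM' : loopless M' by rewrite /loopless eM.
by rewrite !kl_repE // (kl_poly_pull lM sW eM).
Qed.

(** Induction on the rank settles every term of the recursion except that of [set0], whose
    contraction has the same rank as [M] but another ground type. That term is not compared for [P]
    and [Q]: the degree bound makes it vanish in the degrees [k] with [rk M <= 2 * k], and these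
    determine the low coefficients. *)
Lemma eqKL_unique (P Q : forall gT (W : {group gT}) I, eqmatroid W I -> grVRep
  W) :
    eqKL P -> eqKL Q ->
  forall gT (W : {group gT}) I (M : eqmatroid W I),
    loopless M -> P gT W I M = Q gT W I M.
Proof.
move=> KP KQ gT W I M; have [n] := ubnP (rk M).
elim: n => // n IHn in gT W I M *; rewrite ltnS => le_rn lM;
  apply: val_inj => /=.
have [r0|r_gt0] := posnP (rk M); first by rewrite (eqKL_rk0 KP) ?(eqKL_rk0 KQ).
have degP := eqKL_deg KP lM r_gt0; have degQ := eqKL_deg KQ lM r_gt0.
have rcontr : rk (eqcontr M set0) = rk M.
  by rewrite -[RHS](rk_contr M set0) mrank0 addn0.
have lcontr : loopless (eqcontr M set0) by apply/loopless_contr/loopless_flat0.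
have small R : eqKL R -> forall gT' (W' : {group gT'}) I' (M' : eqmatroid W'
  I'),
    loopless M' -> rk M' = rk M -> forall k, (rk M <= 2 * k)%N -> (R gT' W' I'
      M')`_k = 0.
  move=> KR gT' W' I' M' lM' rM' k le_k; rewrite nth_default //.
  have := eqKL_deg KR lM'; rewrite rM' => /(_ r_gt0).
  by move: (size _) => s; lia.
pose t (R : forall gT (W : {group gT}) I, eqmatroid W I -> grVRep W) F :=
    grInd W (eqchar (eqloc M F) * grpoly (R gT (stab M F) (contrI F) (eqcontr M
      F))).
have rec k : (k <= rk M)%N ->
    (P gT W I M)`_(rk M - k) - (t P set0)`_k = (Q gT W I M)`_(rk M - k) - (t Q
      set0)`_k.
  move=> le_k; have recR R : eqKL R -> (R gT W I M)`_(rk M - k) - (t R set0)`_k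
    =
      (\sum_(F in orbit_transversal (eact M)^* W (flats M) | F != set0) t R
        F)`_k.
    move=> KR; have := congr1 (fun P : {poly 'CF(W)} => P`_k) (eqKL_rec KR lM).
    rewrite coef_poly ltnS le_k => ->.
    by rewrite (bigD1 set0) ?set0_reps //= coefD addrC addKr.
  rewrite !recR //; congr (nth 0 (polyseq _) _);
    apply: eq_bigr => F /andP[FX neF].
  rewrite /t IHn //; last exact/loopless_contr/(reps_flat FX).
  by apply: leq_trans le_rn; apply: rk_contr_lt.
(* The localization at [set0] has rank 0, so its characteristic polynomial is constant and does not
   raise the degree. *)
have t_small R k : eqKL R -> (rk M <= 2 * k)%N -> (t R set0)`_k = 0.
  move=> KR le_k; rewrite coef_grInd coefM big1 ?raddf0 // => j _.
  have [j0|j_gt0] := posnP (nat_of_ord j);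
    first by rewrite j0 subn0 (small R) ?mulr0.
  have rloc : rk (localization M set0) = 0%N by rewrite rk_loc mrank0.
  rewrite [X in X * _](_ : _ = 0) ?mul0r // /eqchar rloc big_ord1 subnn coefZ
    coefXn.
  by rewrite (gtn_eqF j_gt0) mulr0.
apply/polyP=> k; have [le_k|lt_k] := leqP (rk M) (2 * k).
  by rewrite !small.
(* A low degree [k] is read off in the complementary degree [rk M - k], which lies in the range of
   [t_small]. *)
have := rec (rk M - k)%N (leq_subr _ _); rewrite !t_small //; try lia.
by rewrite !subr0 subKn //; lia.
Qed.

Theorem theorem2p8 :
  exists P : (forall (gT : finGroupType) (W : {group gT}) (I : finType),
                eqmatroid W I -> grVRep W),
    eqKL P /\
    (forall Q : (forall (gT : finGroupType) (W : {group gT}) (I : finType),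
                   eqmatroid W I -> grVRep W),
       eqKL Q ->
       forall (gT : finGroupType) (W : {group gT}) (I : finType)
              (M : eqmatroid W I),
         loopless M -> Q gT W I M = P gT W I M).
Proof.
exists (@kl_rep); split; first exact: kl_rep_eqKL.
by move=> Q KQ gT W I M; apply: eqKL_unique => //; apply: kl_rep_eqKL.
Qed.
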